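(* Let $n\in\mathbb{N}$, $n\ge 1$, $m>0$, $R>0$, and $1<p<p_{crit}(m,n)$. Let $u_0,u_1\in C_0^\infty(\mathbb{R}^n)$ be nonnegative with support contained in $\{x:|x|\le R\}$. For $\varepsilon>0$ consider the Cauchy problem $$u_{tt}-t^m\Delta u=|u|^p \ \text{ in } \mathbb{R}^n\times[0,\infty),\qquad u(x,0)=\varepsilon u_0(x),\quad u_t(x,0)=\varepsilon u_1(x).$$ There exist $\varepsilon_0>0$ and a constant $C>0$ independent of $\varepsilon$ such that for every $0<\varepsilon\le\varepsilon_0$ the following holds. If $u$ is an energy space solution of this problem on $[0,T)$, where $T=T(\varepsilon)$ is its lifespan, satisfying $$\operatorname{supp} u\subset\{(x,t)\in\mathbb{R}^n\times[0,T): |x|\le R+\phi(t)\},\qquad \phi(t)=\tfrac{2}{m+2}t^{\frac{m+2}{2}},$$ then $T<\infty$ and $$T(\varepsilon)\le C\,\varepsilon^{-\frac{2p(p-1)}{\gamma(m,n,p)}}.$$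
   Context: Define $\gamma(m,n,p)=-\left((m+2)\frac n2-1\right)p^2-\left((m+2)(1-\frac n2)-3\right)p+(m+2)$. The exponent $p_{crit}(m,n)$ is the positive root (in $p$) of $\gamma(m,n,p)=0$. Energy space solution: $u$ is an energy space solution of the problem on $[0,T)$ if $(u,u_t)\in C([0,T),H^1(\mathbb{R}^n)\times L^2(\mathbb{R}^n))$, $u$ attains the initial data $u(x,0)=\varepsilon u_0(x)$, $u_t(x,0)=\varepsilon u_1(x)$, and for every $\zeta\in C_0^\infty(\mathbb{R}^n\times[0,T))$ and every $t\in(0,T)$, $$\int u_t(x,t)\zeta(x,t)\,dx-\int u_t(x,0)\zeta(x,0)\,dx-\int_0^t\!\!\int\big(u_s(x,s)\zeta_s(x,s)-s^m\nabla u(x,s)\cdot\nabla\zeta(x,s)\big)\,dx\,ds=\int_0^t\!\!\int|u(x,s)|^p\zeta(x,s)\,dx\,ds,$$ where the spatial integrals are over $\mathbb{R}^n$. The lifespan $T(\varepsilon)$ is the maximal existence time of the solution.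
   Formalization: The formal theorem additionally assumes that u_0 and u_1 are not both identically zero; for u_0 = u_1 = 0 the zero function is a global energy space solution with empty support, so the claim T < ∞ fails. *)

(* Defs.v *)
From HB Require Import structures.
From mathcomp Require Import all_boot all_order all_algebra.
From mathcomp Require Import all_classical all_reals all_analysis.

Set Implicit Arguments.
Unset Strict Implicit.
Unset Printing Implicit Defensive.

Import Order.TTheory GRing.Theory Num.Theory.
Import numFieldNormedType.Exports.

Local Open Scope classical_set_scope.
Local Open Scope ring_scope.

Definition rV_coord (R : realType) (n : nat) (i : 'I_n) (v : 'rV[R]_n) :
  measurableTypeR R := v ord0 i.

Definition rV_display (R : realType) : measure_display :=
  measure_tuple_display (sigma_display (R.-ocitv.-measurable)).

(* This is the Borel sigma-algebra. *)
HB.instance Definition _ (R : realType) (n : nat) := @isMeasurable.Build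
  (rV_display R) 'rV[R]_n
  (g_sigma_preimage (@rV_coord R n))
  (@sigma_algebra0 _ setT _) (@sigma_algebraC _ _)
  (@sigma_algebra_bigcup _ setT _).

Lemma measurable_fun_rVP d (T : measurableType d) (R : realType) (n : nat)
    (f : T -> 'rV[R]_n) :
  measurable_fun setT f <->
  forall i, measurable_fun setT (@rV_coord R n i \o f).
Proof.
apply: (@iff_trans _
    (g_sigma_preimage (fun i => @rV_coord R n i \o f) `<=` measurable)).
  rewrite g_sigma_preimage_comp; split=> [mf A [/= C preC <-]|prefS].
    exact: mf.
  by move=> _ A mA; apply: prefS; exists A.
split=> [coordfS i|mf].
- move=> _ A mA.
  apply: coordfS; apply: sub_sigma_algebra.
  case: n i => [[] []//|n i] in f *.
  rewrite -bigcup_mkord_ord.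
  exists i; first exact: ltn_ord.
  by exists A => //; rewrite inord_val.
- apply: smallest_sub; first exact: sigma_algebra_measurable.
  case: n => [|n] in f mf *; first by rewrite big_ord0.
  rewrite -bigcup_mkord_ord; apply: bigcup_sub => i Ii.
  by move=> A [B mB <-]; exact: mf.
Qed.

Lemma measurable_rV_coord (R : realType) (n : nat) (i : 'I_n) :
  measurable_fun setT (@rV_coord R n i).
Proof. by have /measurable_fun_rVP := @measurable_id _ 'rV[R]_n setT; exact. Qed.

Definition rV_cons (R : realType) (n : nat)
  (z : measurableTypeR R * 'rV[R]_n) : 'rV[R]_n.+1 :=
  row_mx (const_mx z.1 : 'rV[R]_1) z.2.

Definition rV_uncons (R : realType) (n : nat)
  (v : 'rV[R]_n.+1) : measurableTypeR R * 'rV[R]_n :=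
  (v ord0 ord0, @rsubmx R 1 1 n v).

Lemma rV_consK (R : realType) (n : nat) :
  cancel (@rV_cons R n) (@rV_uncons R n).
Proof.
move=> [a v]; rewrite /rV_uncons /rV_cons /=; congr pair; last exact: row_mxKr.
rewrite (_ : ord0 = @lshift 1 n ord0); last exact: val_inj.
by rewrite (@row_mxEl _ 1 1 n) mxE.
Qed.

Lemma measurable_rV_cons (R : realType) (n : nat) :
  measurable_fun setT (@rV_cons R n).
Proof.
apply/measurable_fun_rVP => i.
have := @splitP 1 n i; case=> [j ij|j ij].
- rewrite (_ : _ \o _ = fst); first exact: measurable_fst.
  apply/funext => z; rewrite /rV_coord /rV_cons /=.
  by rewrite (_ : i = @lshift 1 n j) ?(@row_mxEl _ 1 1 n) ?mxE //; exact: val_inj.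
- rewrite (_ : _ \o _ = @rV_coord R n j \o snd).
    by apply: measurableT_comp; [exact: measurable_rV_coord|exact: measurable_snd].
  apply/funext => z; rewrite /rV_coord /rV_cons /=.
  by rewrite (_ : i = @rshift 1 n j) ?(@row_mxEr _ 1 1 n) //; exact: val_inj.
Qed.

Lemma measurable_rV_uncons (R : realType) (n : nat) :
  measurable_fun setT (@rV_uncons R n).
Proof.
apply: measurable_fun_pair; first exact: (measurable_rV_coord (n := n.+1) ord0).
apply/measurable_fun_rVP => i.
rewrite (_ : _ \o _ = @rV_coord R n.+1 (@rshift 1 n i)).
  exact: measurable_rV_coord.
by apply/funext => v; rewrite /rV_coord /= mxE.
Qed.

Section lebesgue_rVS.
Context (R : realType) (n : nat).
Variable mu : {sigma_finite_measure set 'rV[R]_n -> \bar R}.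
Local Open Scope ereal_scope.

Definition lebesgue_rVS : set 'rV[R]_n.+1 -> \bar R :=
  pushforward (@lebesgue_measure R \x mu) (@rV_cons R n).

Let measurable_preimage (A : set 'rV[R]_n.+1) :
  measurable A -> measurable (@rV_cons R n @^-1` A).
Proof. by move=> mA; rewrite -[X in measurable X]setTI; exact: measurable_rV_cons. Qed.

Let lebesgue_rVS0 : lebesgue_rVS set0 = 0.
Proof. by rewrite /lebesgue_rVS /pushforward preimage_set0 measure0. Qed.

Let lebesgue_rVS_ge0 A : 0 <= lebesgue_rVS A.
Proof. by apply: integral_ge0 => x _; exact: measure_ge0. Qed.

Let lebesgue_rVS_sigma_additive : semi_sigma_additive lebesgue_rVS.
Proof.
move=> F mF tF mUF; rewrite /lebesgue_rVS /pushforward preimage_bigcup.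
apply: measure_semi_sigma_additive.
- by move=> k; exact: measurable_preimage.
- apply/trivIsetP => /= i j _ _ ij; rewrite -preimage_setI.
  by move/trivIsetP : tF => /(_ _ _ _ _ ij) ->//; rewrite preimage_set0.
- by rewrite -preimage_bigcup; exact: measurable_preimage.
Qed.

HB.instance Definition _ := isMeasure.Build _ _ _ lebesgue_rVS
  lebesgue_rVS0 lebesgue_rVS_ge0 lebesgue_rVS_sigma_additive.

Let lebesgue_rVS_sigma_finite : sigma_finite setT lebesgue_rVS.
Proof.
have /sigma_finiteP[F [TF ndF Foo]] := sigma_finiteT (@lebesgue_measure R).
have /sigma_finiteP[G [TG ndG Goo]] := sigma_finiteT mu.
exists (fun k => @rV_uncons R n @^-1` (F k `*` G k)).
  apply/esym; rewrite -preimage_bigcup -subTset => v _ /=.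
  have [i _ Fi] : (\bigcup_i F i) (v ord0 ord0) by rewrite -TF.
  have [j _ Gj] : (\bigcup_i G i) (rV_uncons v).2 by rewrite -TG.
  exists (maxn i j) => //; split => /=.
    by move: Fi; exact/subsetPset/ndF/leq_maxl.
  by move: Gj; exact/subsetPset/ndG/leq_maxr.
move=> k; have [mF Fk] := Foo k; have [mG Gk] := Goo k; split.
  rewrite -[X in measurable X]setTI; apply: measurable_rV_uncons => //.
  exact: measurableX.
rewrite /lebesgue_rVS /pushforward -comp_preimage (_ : _ \o _ = id).
  by rewrite preimage_id product_measure1E// lte_mul_pinfty// ge0_fin_numE.
by apply/funext => z /=; rewrite rV_consK.
Qed.

HB.instance Definition _ := Measure_isSigmaFinite.Build _ _ _ lebesgue_rVS
  lebesgue_rVS_sigma_finite.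

End lebesgue_rVS.

Fixpoint lebesgue_rV (R : realType) (n : nat) :
    {sigma_finite_measure set 'rV[R]_n -> \bar R} :=
  match n with
  | 0%N => [the {sigma_finite_measure set 'rV[R]_0 -> \bar R} of \d_(0 : 'rV[R]_0)]
  | n'.+1 => [the {sigma_finite_measure set 'rV[R]_n'.+1 -> \bar R} of
                lebesgue_rVS (lebesgue_rV R n')]
  end.

Lemma lebesgue_rV_box (R : realType) (n : nat)
    (A : 'I_n -> set (measurableTypeR R)) : (forall i, measurable (A i)) ->
  lebesgue_rV R n [set v : 'rV[R]_n | forall i, A i (v ord0 i)] =
  (\prod_(i < n) @lebesgue_measure R (A i))%E.
Proof.
elim: n A => [|n IHn] A mA.
  by rewrite big_ord0 /= /dirac indicE mem_set// => -[].
rewrite big_ord_recl -IHn//= /lebesgue_rVS /pushforward -product_measure1E//=.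
- congr product_measure1; apply/seteqP; split => -[a v] /=.
  + move=> Aav; split.
      have := Aav (@lshift 1 n ord0).
      rewrite /rV_cons (@row_mxEl _ 1 1 n) mxE (_ : lshift n ord0 = ord0)//.
      exact: val_inj.
    move=> i; have := Aav (@rshift 1 n i).
    by rewrite /rV_cons (@row_mxEr _ 1 1 n) (_ : rshift 1 i = lift ord0 i)//;
      exact: val_inj.
  + move=> [Aa Av] i; rewrite /rV_cons; have := @splitP 1 n i.
    case=> [j ij|j ij].
      have ji : i = @lshift 1 n j by exact: val_inj.
      rewrite ji (@row_mxEl _ 1 1 n) mxE (_ : lshift n j = ord0)//.
      by apply: val_inj; rewrite /= (ord1 j).
    have ji : i = @rshift 1 n j by exact: val_inj.
    rewrite ji (@row_mxEr _ 1 1 n) (_ : rshift 1 j = lift ord0 j)//.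
    exact: val_inj.
- rewrite [X in measurable X](_ : _ = \bigcap_(i in [set: 'I_n])
    (@rV_coord R n i @^-1` A (lift ord0 i))).
    apply: fin_bigcap_measurable => // i _.
    by rewrite -[X in measurable X]setTI; exact: measurable_rV_coord.
  by apply/seteqP; split => v /= Av i; [move=> _|]; exact: Av.
Qed.

(* All iterated directional derivatives up to order [k] exist and are
   continuous; for finite-dimensional [V] this is the class C^k. *)
Fixpoint Ck (R : realType) (V : normedModType R) (k : nat) (f : V -> R) : Prop :=
  match k with
  | 0%N => continuous f
  | k'.+1 => continuous f /\
      forall v : V, (forall x, derivable f x v) /\ Ck k' (fun x => 'D_v f x)
  end.

Definition smooth (R : realType) (V : normedModType R) (f : V -> R) : Prop :=
  forall k, Ck k f.

Definition supp (R : realType) (V : normedModType R) (f : V -> R) : set V :=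
  closure [set x | f x != 0].

Definition test_function (R : realType) (V : normedModType R) (f : V -> R) : Prop :=
  smooth f /\ compact (supp f).

(* The norm of ['rV[R]_n] in the library is the maximum norm. *)
Definition enorm (R : realType) (n : nat) (x : 'rV[R]_n) : R :=
  Num.sqrt (\sum_(i < n) x ord0 i ^+ 2).

(* Points of space-time are pairs [(t, x)], time first. *)
Definition spacetime (R : realType) (n : nat) : normedModType R :=
  (R^o * 'rV[R]_n)%type.

Definition dt (R : realType) (n : nat) (f : spacetime R n -> R)
    (z : spacetime R n) : R := 'D_(1, 0) f z.

Definition dx (R : realType) (n : nat) (i : 'I_n) (f : spacetime R n -> R)
    (z : spacetime R n) : R := 'D_(0, delta_mx ord0 i) f z.

(* C_0^oo(R^n x [0,T)): smooth up to t = 0 is taken to mean restriction of an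
   element of C_0^oo(R^n x (-oo,T)). *)
Definition spacetime_test_function (R : realType) (n : nat) (T : \bar R)
    (zeta : spacetime R n -> R) : Prop :=
  test_function zeta /\ supp zeta `<=` [set z | (z.1%:E < T)%E].

Section energy_space.
Context (R : realType) (n : nat).
Local Notation leb := (lebesgue_rV R n).

Definition L2 (f : 'rV[R]_n -> R) : Prop := f \in Lfun leb 2%:E.

Definition L2norm (f : 'rV[R]_n -> R) : \bar R := ('N[leb]_2%:E[EFin \o f])%E.

Definition weak_partial (i : 'I_n) (f g : 'rV[R]_n -> R) : Prop :=
  forall phi : 'rV[R]_n -> R, test_function phi ->
    \int[leb]_x (f x * 'D_(delta_mx ord0 i) phi x) =
    - \int[leb]_x (g x * phi x).

Definition H1 (f : 'rV[R]_n -> R) (grad : 'I_n -> 'rV[R]_n -> R) : Prop :=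
  L2 f /\ forall i, L2 (grad i) /\ weak_partial i f (grad i).

Definition time_interval (T : \bar R) : set R :=
  [set t | 0 <= t /\ (t%:E < T)%E].

Definition L2_continuous (T : \bar R) (f : R -> 'rV[R]_n -> R) : Prop :=
  forall t, time_interval T t ->
    L2norm (fun x => f s x - f t x)
      @[s --> within (time_interval T) (nbhs t)] --> 0%E.

(* At t = 0 this is the right derivative. *)
Definition L2_derivative (T : \bar R) (f f' : R -> 'rV[R]_n -> R) : Prop :=
  forall t, time_interval T t ->
    L2norm (fun x => (f s x - f t x) / (s - t) - f' t x)
      @[s --> within (time_interval T `\` [set t]) (nbhs t)] --> 0%E.

End energy_space.

Section tricomi.
Context (R : realType) (n : nat).
Local Notation leb := (lebesgue_rV R n).
Local Notation leb1 := (@lebesgue_measure R).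

(* The right-hand side is an extended-real integral, so that testing with
   [0 <= zeta] makes the identity assert the local integrability of |u|^p. *)
Definition weak_identity (m p : R) (T : \bar R) (u ut : R -> 'rV[R]_n -> R)
    (gradu : R -> 'I_n -> 'rV[R]_n -> R) : Prop :=
  forall zeta : spacetime R n -> R, spacetime_test_function T zeta ->
  forall t : R, 0 < t -> (t%:E < T)%E ->
    (\int[leb]_x (ut t x * zeta (t, x)) - \int[leb]_x (ut 0 x * zeta (0, x))
     - \int[leb1]_(s in `[0, t]) \int[leb]_x
         (ut s x * dt zeta (s, x)
          - s `^ m * \sum_(i < n) gradu s i x * dx i zeta (s, x)))%:E
    = (\int[leb1]_(s in `[0%R, t]) \int[leb]_x
         (`|u s x| `^ p * zeta (s, x))%:E)%E.

Definition energy_solution (m p eps : R) (u0 u1 : 'rV[R]_n -> R) (T : \bar R)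
    (u : R -> 'rV[R]_n -> R) : Prop :=
  exists (ut : R -> 'rV[R]_n -> R) (gradu : R -> 'I_n -> 'rV[R]_n -> R),
    [/\ (0 < T)%E,
        [/\ forall t, time_interval T t -> H1 (u t) (gradu t),
            L2_continuous T u
          & forall i, L2_continuous T (fun t => gradu t i)],
        [/\ forall t, time_interval T t -> L2 (ut t),
            L2_continuous T ut
          & L2_derivative T u ut],
        {ae leb, forall x, u 0 x = eps * u0 x} /\
        {ae leb, forall x, ut 0 x = eps * u1 x}
      & weak_identity m p T u ut gradu].

(* [T] is the maximal existence time of [u]: no energy space solution on a
   longer interval agrees with [u] on [0,T). *)
Definition energy_solution_with_lifespan (m p eps : R) (u0 u1 : 'rV[R]_n -> R)
    (T : \bar R) (u : R -> 'rV[R]_n -> R) : Prop :=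
  energy_solution m p eps u0 u1 T u /\
  forall (T' : \bar R) (v : R -> 'rV[R]_n -> R), (T < T')%E ->
    energy_solution m p eps u0 u1 T' v ->
    ~ (forall t, time_interval T t -> {ae leb, forall x, v t x = u t x}).

(* Support in R^n x [0,T) of an L^2-valued function of time: values of [u t]
   on null sets are disregarded. *)
Definition solution_supp (T : \bar R) (u : R -> 'rV[R]_n -> R) :
    set (spacetime R n) :=
  [set z | time_interval T z.1 /\
    forall U : set (spacetime R n), open_nbhs z U ->
      ~ (forall t, time_interval T t ->
           {ae leb, forall x, U (t, x) -> u t x = 0})].

End tricomi.

Section exponents.
Context (R : realType).

Definition gamma (m : R) (n : nat) (p : R) : R :=
  - ((m + 2) * (n%:R / 2) - 1) * p ^+ 2
  - ((m + 2) * (1 - n%:R / 2) - 3) * p + (m + 2).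

(* For [0 < m] and [0 < n] the positive root exists and is unique. *)
Definition p_crit (m : R) (n : nat) : R :=
  xget 0 [set q | 0 < q /\ gamma m n q = 0].

Definition phi (m t : R) : R := 2 / (m + 2) * t `^ ((m + 2) / 2).

End exponents.

(* Main.v *)
(* Test the equation against exp(w.x), which is harmless because u(t) has
   compact support. For |w| = 1 the average of u against exp(w.x) satisfies
   f'' >= t^m f, so WKB comparison gives f_w(t) >= c eps t^(-m/4) exp(phi(t)).
   On |x| <= rho := R + phi(t) the directions w tile the sphere in about
   rho^((n-1)/2) caps, one for each plane wave that is essentially supported
   near a boundary point; a Hoelder estimate for each w, summed over the caps,
   bounds the integral of |u|^p below by c eps^p t^b with
   b = (n-1)(2-p)(m+2)/4 - mp/4. Hence F(t), the integral of u, which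
   satisfies F'' = int |u|^p, is at least c eps^p t^(b+2). Since also
   F'' >= c t^(-n(p-1)(m+2)/2) F^p, F doubles along steps of geometrically
   decreasing length and blows up in [t, 2t] as soon as
   eps^(p(p-1)) t^(gamma/2) is large. *)

Require Import Defs.
From HB Require Import structures.
From mathcomp Require Import all_boot all_order all_algebra.
From mathcomp Require Import all_classical all_reals all_analysis.
From mathcomp Require Import measurable_realfun ring lra.
Import Order.TTheory GRing.Theory Num.Theory.
Import numFieldNormedType.Exports.
Local Open Scope classical_set_scope.
Local Open Scope ring_scope.

Set Implicit Arguments.
Unset Strict Implicit.
Unset Printing Implicit Defensive.

(** * Comparison with the WKB subsolution *)

(** The equation is available only in integrated form: the increment of the tested velocity is a
    time integral of exponential means of |u|^p, which are not known to be measurable or finite in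
    time. So no second derivative is ever formed. The ODE arguments concern three functions: f, its
    derivative v, and a primitive I of the linear term, whose increments are at most those of v.
    Single plane waves replace the customary average of exp(w.x) over the sphere: each obeys its own
    ODE and finitely many suffice, so neither surface measure nor Bessel asymptotics occur. The
    power b is a count, with rho = R + phi(t). By Hoelder one direction yields G^p / A^(p-1), with G
    about eps t^(-m/4) exp(rho) and A about rho^((n-1)/2) exp(rho), the integral of the wave over
    the ball. There are about rho^((n-1)/2) directions, whose waves add up to at most C exp(rho).
    After division by exp(rho) the exponentials cancel and eps^p t^(-mp/4) rho^((n-1)(2-p)/2)
    remains, where rho is about t^((m+2)/2). The final power of t is 2 - n(p-1)(m+2)/2 + (p-1)(b+2)
    = gamma/2, positive for p below the critical exponent. *)

Lemma gt0_powRD (R : realType) (x a b : R) :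
  0 < x -> x `^ (a + b) = x `^ a * x `^ b.
Proof. by move=> x0; rewrite powRD// (gt_eqF x0) implybT. Qed.

(* Unlike [is_derive], not a type class: no instance search on open goals. *)
Definition has_derivative (R : realType) (f : R -> R) (x df : R) : Prop :=
  is_derive x 1 f df.

Lemma within_continuousB (R : realType) (A : set R) (f g : R -> R) :
  {within A, continuous f} -> {within A, continuous g} ->
  {within A, continuous (f - g)}.
Proof. by move=> cf cg x; apply: cvgB; [exact: cf|exact: cg]. Qed.

Lemma within_continuousZ (R : realType) (A : set R) (k : R) (f : R -> R) :
  {within A, continuous f} -> {within A, continuous (k *: f)}.
Proof. by move=> cf x; apply: continuousZr; exact: cf. Qed.

Lemma le_derive_ge0 (R : realType) (f df : R -> R) (a b : R) :
  a <= b -> {within `[a, b], continuous f} ->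
  (forall x, x \in `]a, b[ -> has_derivative f x (df x)) ->
  (forall x, x \in `]a, b[ -> 0 <= df x) -> f a <= f b.
Proof.
rewrite le_eqVlt => /predU1P[-> //|ab] cf df_ df0.
have [c cab fE] := MVT ab df_ cf.
by rewrite -subr_ge0 fE mulr_ge0 ?df0// subr_ge0 ltW.
Qed.

Lemma within_itv_cvg (R : realType) (f : R -> R) (a b x : R) :
  {within `[a, b], continuous f} -> x \in `[a, b] ->
  forall e, 0 < e -> exists2 d, 0 < d &
    forall y, y \in `[a, b] -> `|x - y| < d -> `|f x - f y| < e.
Proof.
move=> /subspace_continuousP cf xab e e0.
have /cvgrPdist_lt/(_ e e0) := cf x xab.
rewrite near_withinE => -[d /= d0 dP]; exists d => // y yab yd.
by apply: dP => //.
Qed.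

(** First-zero argument: if f were negative somewhere, let [u] be the infimum of the points where f
    <= 0. Continuity gives f u <= 0, whereas f > 0 on [a, u[ makes [df] nonnegative there, so that f
    u >= f a > 0. *)
Lemma pos_persist (R : realType) (f df : R -> R) (a b : R) :
  {within `[a, b], continuous f} ->
  (forall x, x \in `]a, b[ -> has_derivative f x (df x)) -> 0 < f a ->
  (forall t, t \in `]a, b[ ->
     (forall s, s \in `[a, t] -> 0 <= f s) -> 0 <= df t) ->
  forall t, t \in `[a, b] -> 0 <= f t.
Proof.
move=> cf dfE fa dfP t tab; rewrite leNgt; apply/negP => ft.
pose S := [set s | s \in `[a, t] /\ f s <= 0].
have St : S t by split; [move: tab; rewrite !in_itv/= => /andP[->]/=|exact: ltW].
have lbS : lbound S a by move=> s [+ _]; rewrite in_itv/= => /andP[].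
have hS : has_inf S by split; [exists t|exists a].
set u := inf S.
have au : a <= u by apply: lb_le_inf => //; exists t.
have ut : u <= t by apply: ge_inf => //; exists a.
have tb : t <= b by move: tab; rewrite in_itv/= => /andP[].
have uab : u \in `[a, b] by rewrite in_itv/= au (le_trans ut).
have fpos s : a <= s -> s < u -> 0 < f s.
  move=> as_ su; rewrite ltNge; apply/negP => fs.
  have := su; rewrite ltNge => /negP; apply; apply: ge_inf; first by exists a.
  by split => //; rewrite in_itv/= as_/= (le_trans (ltW su)).
have fu : f u <= 0.
  rewrite leNgt; apply/negP => fu.
  have [d d0 dP] := within_itv_cvg cf uab fu.
  have [s [sat fs] sud] := inf_adherent d0 hS.
  have /andP[as_ st] : a <= s <= t by move: sat; rewrite in_itv.
  have us : u <= s by apply: ge_inf; [exists a|].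
  have := dP s; rewrite in_itv/= as_ (le_trans st tb) => /(_ isT).
  rewrite distrC ger0_norm ?subr_ge0// ltrBlDl => /(_ sud).
  by rewrite ltr_norml => /andP[]; lra.
suff : f a <= f u by lra.
refine (@le_derive_ge0 R f df a u au _ _ _).
- apply: continuous_subspaceW cf => x /=; rewrite !in_itv/= => /andP[-> xu]/=.
  by rewrite (le_trans xu) // (le_trans ut).
- move=> x /[!in_itv]/= /andP[ax xu]; apply: dfE; rewrite in_itv/= ax.
  by rewrite (lt_le_trans xu) // (le_trans ut).
- move=> x /[!in_itv]/= /andP[ax xu]; apply: dfP.
    by rewrite in_itv/= ax (lt_le_trans xu) // (le_trans ut).
  move=> s /[!in_itv]/= /andP[as_ sx]; apply/ltW/fpos => //.
  exact: le_lt_trans xu.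
Qed.

(** Integrated form of d'' >= c d: the derivative [D] of d is controlled only through increments of
    [E]. Adding g exp(k x) with k^2 >= K makes the initial value strictly positive and preserves the
    inequality, so [pos_persist] applies; then g tends to 0. *)
Lemma comparison (R : realType) (d D E e c : R -> R) (a b K : R) :
  {within `[a, b], continuous d} -> {within `[a, b], continuous E} ->
  (forall x, x \in `]a, b[ -> has_derivative d x (D x)) ->
  (forall x, x \in `]a, b[ -> has_derivative E x (e x)) ->
  (forall x, x \in `]a, b[ -> c x * d x <= e x) ->
  (forall x, x \in `]a, b[ -> 0 <= c x <= K) ->
  0 <= d a -> (forall x, x \in `]a, b[ -> E x - E a <= D x) ->
  forall t, t \in `[a, b] -> 0 <= d t.
Proof.
move=> cd cE dD dE ce cK da DE t tab.
pose k : R := 1 + `|K|.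
have k1 : 1 <= k by rewrite lerDl.
have k0 : 0 < k by lra.
have Kk : K <= k ^+ 2.
  have := ler_norm K; have : k <= k ^+ 2 by rewrite expr2 ler_peMl // ltW.
  by rewrite /k; lra.
pose w : R -> R := fun x => expR (k * x).
have w_gt0 x : 0 < w x by exact: expR_gt0.
have dw (x : R) : has_derivative w x (k * w x).
  by rewrite /w; apply: is_derive_eq; rewrite /GRing.scale/=; ring.
have cw A : {within A, continuous w}.
  apply: continuous_subspaceT => x; apply: differentiable_continuous.
  by apply/derivable1_diffP; have [] := dw x.
(* [g] is scaled so that the perturbation equals the arbitrary [de] at the time t under test. *)
apply/ler_addgt0Pr => de de0.
pose g : R := de / w t; have g0 : 0 < g by rewrite divr_gt0.
suff : 0 <= (d + g *: w) t.
  by rewrite -[(_ + _) t]/(d t + g * w t) /g divfK ?gt_eqF.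
have dD' x : x \in `]a, b[ -> has_derivative (d + g *: w) x (D x + g * (k * w x)).
  by move=> xab; exact: (is_deriveD (dD x xab) (is_deriveZ g (dw x))).
have dE' x : x \in `]a, b[ ->
    has_derivative (E + (g * k) *: w) x (e x + (g * k) * (k * w x)).
  by move=> xab; exact: (is_deriveD (dE x xab) (is_deriveZ (g * k) (dw x))).
have cont f h : {within `[a, b], continuous f} ->
    {within `[a, b], continuous (f + h *: w)}.
  move=> cf x; apply: continuousD; first exact: cf.
  by apply: continuousZr; exact: cw.
apply: (@pos_persist _ _ (fun x => D x + g * (k * w x)) a b) => //.
- exact: cont.
- by rewrite fctE/= ltr_wpDl// mulr_gt0.
move=> s sab ds.
have sab' := sab; move: sab'; rewrite in_itv/= => /andP[as_ sb].
have EE : (E + (g * k) *: w) a <= (E + (g * k) *: w) s.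
  refine (@le_derive_ge0 R _ (fun x => e x + (g * k) * (k * w x)) a s (ltW as_) _ _ _).
  - apply: (continuous_subspaceW _ (cont E (g * k) cE)) => x /=.
    by rewrite !in_itv/= => /andP[-> /le_trans] /(_ _ (ltW sb)).
  - move=> x /[!in_itv]/= /andP[ax xs]; apply: dE'; rewrite in_itv/= ax.
    exact: lt_trans xs sb.
  - move=> x /[!in_itv]/= /andP[ax xs].
    have xab : x \in `]a, b[ by rewrite in_itv/= ax (lt_trans xs).
    have dx0 : 0 <= (d + g *: w) x by apply: ds; rewrite in_itv/= !ltW.
    have /andP[c0 cKx] := cK x xab; have cex := ce x xab.
    have dx0' : 0 <= d x + g * w x by [].
    have : 0 <= c x * (d x + g * w x) by rewrite mulr_ge0.
    have : c x * (g * w x) <= k ^+ 2 * (g * w x).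
      by apply: ler_wpM2r; [rewrite mulr_ge0 ?ltW|exact: le_trans Kk].
    move=> h1 h2; rewrite (_ : g * k * (k * w x) = k ^+ 2 * (g * w x)); [lra|ring].
have := DE s sab; move: EE; rewrite -![(_ + _) _]/(E _ + g * k * w _).
have := mulr_ge0 (mulr_ge0 (ltW g0) (ltW k0)) (ltW (w_gt0 a)).
rewrite mulrA; lra.
Qed.

Section growth.
Variables (R : realType) (m : R).
Hypothesis m_gt0 : 0 < m.

Let mu := m / 4.

(** Logarithmic derivative of the function [y] below: y' = w y, hence y'' = (w^2 + w') y. *)
Let w (t : R) := t `^ (m / 2) - mu / t - t^-1 ^+ 2.

Let y (t : R) := expR (phi m t - mu * ln t + t^-1).

Let is_derive_inv (t : R) : 0 < t -> is_derive t 1 (fun s : R => s^-1) (- t^-1 ^+ 2).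
Proof.
move=> t0; apply: is_derive_eq; first by apply: is_deriveV; rewrite ?gt_eqF.
by rewrite /GRing.scale/= mulr1 exprVn.
Qed.

Let dpow (t a : R) : 0 < t -> is_derive t 1 (fun s : R => s `^ a) (a * t `^ (a - 1)).
Proof. by move=> t0; exact: is_derive1_powR. Qed.

Let dphi (t : R) : 0 < t -> is_derive t 1 (phi m) (t `^ (m / 2)).
Proof.
move=> t0; rewrite /phi; have ? := dpow ((m + 2) / 2) t0.
apply: is_derive_eq; rewrite /GRing.scale/=.
have -> : (m + 2) / 2 - 1 = m / 2 by field.
have m2 : 0 < m + 2 by rewrite addr_gt0.
have e : 2 / (m + 2) * ((m + 2) / 2) = 1 by field; rewrite gt_eqF.
by rewrite mulrA e mul1r.
Qed.

Let dy (t : R) : 0 < t -> is_derive t 1 y (w t * y t).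
Proof.
move=> t0; rewrite /y; have ? := dphi t0; have ? := is_derive_inv t0.
have ? := is_derive1_ln t0.
apply: is_derive_eq; rewrite /GRing.scale/= /w; ring.
Qed.

Let w' (t : R) := m / 2 * t `^ (m / 2 - 1) + mu * t^-1 ^+ 2 + 2 * t^-1 ^+ 3.

Let dw (t : R) : 0 < t -> is_derive t 1 w (w' t).
Proof.
move=> t0; rewrite /w; have ? := dpow (m / 2) t0; have ? := is_derive_inv t0.
apply: is_derive_eq; rewrite /GRing.scale/= /w'; ring.
Qed.

Let dy' (t : R) : 0 < t ->
  is_derive t 1 (fun s => w s * y s) ((w t ^+ 2 + w' t) * y t).
Proof.
move=> t0; have ? := dy t0; have ? := dw t0.
apply: is_derive_eq; rewrite /GRing.scale/=; ring.
Qed.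

(** From [T0] on, t^(m/2) is at least (mu + 2)^2, enough to absorb the lower-order terms of
    [subsol]. *)
Let T0 : R := 2 + ((mu + 2) ^+ 2) `^ (2 / m).

(* WKB: [y ~ t^(-m/4) exp (phi t)]; the factor [exp (1/t)] makes it a
   subsolution of [y'' = t^m y] for large [t]. *)
Let subsol (t : R) : T0 <= t -> w t ^+ 2 + w' t <= t `^ m.
Proof.
move=> tT; have m0 := m_gt0.
have mu0 : 0 < mu by rewrite /mu divr_gt0.
have t2 : 2 <= t by apply: le_trans tT; rewrite /T0 lerDl powR_ge0.
have t0 : 0 < t by lra.
have q : (mu + 2) ^+ 2 <= t `^ (m / 2).
  have -> : (mu + 2) ^+ 2 = (((mu + 2) ^+ 2) `^ (2 / m)) `^ (m / 2).
    have e : 2 / m * (m / 2) = 1 by field; rewrite gt_eqF.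
    by rewrite -powRrM e powRr1// sqr_ge0.
  apply: ge0_ler_powR; rewrite ?nnegrE ?powR_ge0//; [lra|lra|].
  by apply: le_trans tT; rewrite /T0 lerDr.
have mE : t `^ m = (t `^ (m / 2)) ^+ 2.
  by rewrite -powR_mulrn ?powR_ge0// -powRrM; congr (_ `^ _); field.
have pE : t `^ (m / 2 - 1) = t `^ (m / 2) * t^-1.
  by rewrite gt0_powRD// powR_inv1// ltW.
rewrite /w /w' mE pE; move: q; set A := t `^ (m / 2) => q.
have i0 : 0 < t^-1 by rewrite invr_gt0.
have i1 : t^-1 <= 1 by rewrite invf_le1//; lra.
set i := t^-1 in i0 i1 *.
have mE4 : m = 4 * mu by rewrite /mu; field.
rewrite mE4 -subr_ge0.
(* With A = t^(m/2) and i = 1/t, the terms of order A i cancel because mu = m/4; the summand 1/t in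
   the exponent of [y] leaves 2 A i^2, which dominates the rest. *)
have -> : A ^+ 2 - ((A - mu * i - i ^+ 2) ^+ 2 + (4 * mu / 2 * (A * i) +
    mu * i ^+ 2 + 2 * i ^+ 3)) =
    i ^+ 2 * (2 * A - ((mu + i) ^+ 2 + mu + 2 * i)) by field.
apply: mulr_ge0; first exact: sqr_ge0.
rewrite subr_ge0; have : (mu + i) ^+ 2 <= (mu + 1) ^+ 2.
  by rewrite lerXn2r ?nnegrE; lra.
have := mu0; nra.
Qed.

(** Two comparisons. The first, with the affine function b0 + b1 t, carries the data to time [T0],
    where f and v are both at least b0 + b1; the second starts at [T0] and is with a multiple of
    [y]. The constants depend on m alone, hence neither on the direction w nor on eps. *)
Lemma growth : exists t0 c : R, [/\ 2 <= t0, 0 < c &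
  forall (b0 b1 b : R) (f v I : R -> R), 0 <= b0 -> 0 <= b1 -> t0 <= b ->
  {within `[0, b], continuous f} -> {within `[0, b], continuous I} ->
  (forall x, x \in `]0, b[ -> has_derivative f x (v x)) ->
  (forall x, x \in `]0, b[ -> has_derivative I x (x `^ m * f x)) ->
  (forall s t, 0 <= s -> s <= t -> t <= b -> I t - I s <= v t - v s) ->
  b0 <= f 0 -> b1 <= v 0 ->
  c * (b0 + b1) * (b `^ (- (m / 4)) * expR (phi m b)) <= f b].
Proof.
have m0 := m_gt0; have T2 : 2 <= T0 by rewrite /T0 lerDl powR_ge0.
have y0 t : 0 < y t by exact: expR_gt0.
(* [k] exceeds y and |y'| at [T0], so (b0 + b1) y / k starts there below f, with a slope at most
   that of f. *)
pose k := 1 + y T0 + `|w T0 * y T0|.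
have k0 : 0 < k by rewrite /k ltr_pwDl// addr_gt0.
exists T0, k^-1; split; rewrite ?invr_gt0// => b0 b1 b f v I.
move=> b00 b10 Tb cf cI df dI vI f0 v0.
have bT0 : 0 < b by lra.
have cle (a t : R) : 0 < t -> 0 <= t `^ a by rewrite powR_ge0.
have cm x : x \in `]0, b[ -> 0 <= x `^ m <= b `^ m.
  rewrite in_itv/= => /andP[x0 xb]; rewrite powR_ge0/=.
  by apply: ge0_ler_powR; rewrite ?nnegrE; lra.
have cid A : {within A, continuous (fun t => b0 + b1 * t) : R -> R}.
  apply: continuous_subspaceT => x; apply: cvgD; first exact: cvg_cst.
  by apply: cvgM; [exact: cvg_cst|exact: cvg_id].
have F t : t \in `[0, b] -> b0 + b1 * t <= f t.
  move=> tb; rewrite -subr_ge0.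
  apply: (@comparison R (f - (fun t => b0 + b1 * t)) (fun t => v t - b1) I
    (fun t => t `^ m * f t) (fun t => t `^ m) 0 b (b `^ m)) => //.
  - exact: within_continuousB.
  - move=> x xb; have ? := df x xb.
    have ? : is_derive x 1 (fun t => b0 + b1 * t) b1.
      by apply: is_derive_eq; rewrite /GRing.scale/=; ring.
    exact: is_deriveB.
  - move=> x /[dup] xb; rewrite in_itv/= => /andP[x0 _].
    rewrite ler_wpM2l ?powR_ge0// -[X in X <= _]/(f x - (b0 + b1 * x)).
    by rewrite gerBl addr_ge0// mulr_ge0// ltW.
  - by rewrite -[X in _ <= X]/(f 0 - (b0 + b1 * 0)); lra.
  - move=> x; rewrite in_itv/= => /andP[x0 xb].
    by have := vI 0 x (lexx _) (ltW x0) (ltW xb); lra.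
have fb0 t : t \in `[0, b] -> b0 <= f t.
  move=> tb; apply: le_trans (F t tb); rewrite lerDl mulr_ge0//.
  by move: tb; rewrite in_itv => /andP[].
have subI s t : 0 <= s -> t <= b -> {within `[s, t], continuous I}.
  move=> s0 tb; apply: continuous_subspaceW cI => x /=.
  rewrite !in_itv/= => /andP[sx xt]; rewrite (le_trans s0)//=.
  exact: le_trans tb.
have I1 : I 0 <= I 1.
  apply: (@le_derive_ge0 R I (fun t => t `^ m * f t)) => //.
  - by apply: subI => //; lra.
  - by move=> x; rewrite in_itv/= => /andP[x0 xb]; apply: dI; rewrite in_itv/=; lra.
  - move=> x; rewrite in_itv/= => /andP[x0 xb]; rewrite mulr_ge0 ?powR_ge0//.
    by apply: le_trans (fb0 x _) => //; rewrite in_itv/=; lra.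
(* The contribution of b0 to the slope at [T0] comes from f itself: on [1, T0], of length at least
   1, x^m f >= f >= b0. *)
have IT : b0 <= I T0 - I 1.
  have cI' : {within `[1, T0], continuous I} by apply: subI; lra.
  have : (I - (fun t => b0 * t)) 1 <= (I - (fun t => b0 * t)) T0.
    apply: (@le_derive_ge0 R _ (fun t => t `^ m * f t - b0)); first by lra.
    - apply: within_continuousB => //.
      apply: continuous_subspaceT => z.
      by apply: cvgM; [exact: cvg_cst|exact: cvg_id].
    - move=> x; rewrite in_itv/= => /andP[x0 xb].
      have ? : has_derivative I x (x `^ m * f x) by apply: dI; rewrite in_itv/=; lra.
      have ? : is_derive x 1 (fun t => b0 * t) b0.
        by apply: is_derive_eq; rewrite /GRing.scale/=; ring.
      exact: is_deriveB.
    - move=> x; rewrite in_itv/= => /andP[x0 xb]; rewrite subr_ge0.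
      have fx : b0 <= f x by apply: fb0; rewrite in_itv/=; lra.
      have fx0 := le_trans b00 fx; apply: le_trans fx _; rewrite ler_peMl//.
      by rewrite -(powRr0 x); apply: ler_powR; lra.
  rewrite -![(_ - _) _]/(I _ - b0 * _).
  have : b0 * 2 <= b0 * T0 by rewrite ler_wpM2l.
  lra.
have vT : b0 + b1 <= v T0.
  by have := vI 0 T0 (lexx _); rewrite Tb => /(_ _ isT); lra.
have fT : b0 + b1 <= f T0.
  apply: le_trans (F T0 _); last by rewrite in_itv/=; lra.
  by rewrite lerD2l ler_peMr//; lra.
pose g := k^-1 * (b0 + b1).
have g0 : 0 <= g by rewrite mulr_ge0 ?invr_ge0 ?addr_ge0// ltW.
have gk x : x <= k -> g * x <= b0 + b1.
  move=> xk; rewrite /g mulrAC mulrC ler_piMr ?addr_ge0//.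
  by rewrite mulrC ler_pdivrMr// mul1r.
have cy t : 0 < t -> {for t, continuous y}.
  move=> t0; apply: differentiable_continuous; apply/derivable1_diffP.
  by have [] := dy t0.
have cwy t : 0 < t -> {for t, continuous (fun s => w s * y s)}.
  move=> t0; apply: differentiable_continuous; apply/derivable1_diffP.
  by have [] := dy' t0.
have FB : 0 <= (f - g *: y) b.
  have sub (h : R -> R) : {within `[0, b], continuous h} ->
      {within `[T0, b], continuous h}.
    apply: continuous_subspaceW => x /=.
    by rewrite !in_itv/=; lra.
  apply: (@comparison R (f - g *: y) (fun t => v t - g * (w t * y t))
    (I - g *: (fun s => w s * y s))
    (fun t => t `^ m * f t - g * ((w t ^+ 2 + w' t) * y t))
    (fun t => t `^ m) T0 b (b `^ m)) => //.
  - apply: within_continuousB; first exact: sub.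
    apply: within_continuousZ; apply: continuous_in_subspaceT => z.
    by rewrite inE/= in_itv/= => /andP[z1 z2]; apply: cy; lra.
  - apply: within_continuousB; first exact: sub.
    apply: within_continuousZ; apply: continuous_in_subspaceT => z.
    by rewrite inE/= in_itv/= => /andP[z1 z2]; apply: cwy; lra.
  - move=> x; rewrite in_itv/= => /andP[x0 xb].
    have ? : has_derivative f x (v x) by apply: df; rewrite in_itv/=; lra.
    have ? : is_derive x 1 y (w x * y x) by apply: dy; lra.
    exact: is_deriveB.
  - move=> x; rewrite in_itv/= => /andP[x0 xb].
    have ? : has_derivative I x (x `^ m * f x) by apply: dI; rewrite in_itv/=; lra.
    have ? := dy' (ltac:(lra) : 0 < x).
    exact: is_deriveB.
  - move=> x; rewrite in_itv/= => /andP[x0 xb].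
    have -> : (f - g *: y) x = f x - g * y x by [].
    have : g * ((w x ^+ 2 + w' x) * y x) <= g * (x `^ m * y x).
      rewrite ler_wpM2l// ler_wpM2r ?(ltW (y0 _))//.
      by apply: subsol; exact: ltW.
    by rewrite mulrBr [x `^ m * (g * _)]mulrCA; lra.
  - by move=> x; rewrite in_itv/= => /andP[x0 xb]; apply: cm; rewrite in_itv/=; lra.
  - have -> : (f - g *: y) T0 = f T0 - g * y T0 by [].
    rewrite subr_ge0.
    apply: le_trans fT; apply: gk; by rewrite /k -addrA addrCA lerDl addr_ge0.
  - move=> x; rewrite in_itv/= => /andP[x0 xb].
    have e t : (I - g *: (fun s => w s * y s)) t = I t - g * (w t * y t) by [].
    rewrite !e.
    have := vI T0 x ltac:(lra) (ltW x0) (ltW xb).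
    have : g * (w T0 * y T0) <= b0 + b1.
      apply: gk; apply: le_trans (ler_norm _) _.
      by rewrite /k lerDr addr_ge0// ltW.
    lra.
  - by rewrite in_itv/= lexx andbT.
have : 0 <= f b - g * y b by [].
rewrite subr_ge0; apply: le_trans.
(* The factor exp(1/b) >= 1 of [y] is dropped. *)
rewrite ler_wpM2l// /y /powR gt_eqF// -expRD ler_expR.
have : 0 < b^-1 by rewrite invr_gt0.
rewrite /mu; lra.
Qed.

End growth.

(** * Smooth functions and test functions *)

Section Ck_theory.
Context (R : realType).
Implicit Types V W : normedModType R.

Lemma Ck_continuous V k (f : V -> R) : Ck k f -> continuous f.
Proof. by case: k => [//|k] []. Qed.

Lemma CkW V k (f : V -> R) : Ck k.+1 f -> Ck k f.
Proof.
elim: k f => [|k IHk] f; first by case.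
by move=> [cf dfk]; split => // v; have [df /IHk] := dfk v.
Qed.

Lemma eq_Ck V k (f g : V -> R) : f =1 g -> Ck k f -> Ck k g.
Proof. by move=> /funext ->. Qed.

Lemma Ck_cst V k (c : R) : Ck k ((fun=> c) : V -> R).
Proof.
elim: k c => [|k IHk] c /=; first by move=> x; exact: cvg_cst.
split=> [x|v]; first exact: cvg_cst.
split=> [x|]; first exact: derivable_cst.
by apply: (eq_Ck _ (IHk 0)) => x; rewrite derive_cst.
Qed.

Lemma CkD V k (f g : V -> R) : Ck k f -> Ck k g -> Ck k (fun x => f x + g x).
Proof.
elim: k f g => [|k IHk] f g /=; first by move=> cf cg x; apply: cvgD; [exact: cf|exact: cg].
move=> [cf df] [cg dg]; split=> [x|v]; first by apply: cvgD; [exact: cf|exact: cg].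
have [dfv Dfv] := df v; have [dgv Dgv] := dg v.
split=> [x|]; first exact: derivableD.
apply: (@eq_Ck _ _ (fun x => 'D_v f x + 'D_v g x)) => [x|]; last exact: IHk.
by rewrite deriveD.
Qed.

Lemma CkM V k (f g : V -> R) : Ck k f -> Ck k g -> Ck k (fun x => f x * g x).
Proof.
elim: k f g => [|k IHk] f g; first by move=> cf cg x; apply: cvgM; [exact: cf|exact: cg].
move=> Cf Cg; have [cf df] := Cf; have [cg dg] := Cg.
split=> [x|v]; first by apply: cvgM; [exact: cf|exact: cg].
have [dfv Dfv] := df v; have [dgv Dgv] := dg v.
split=> [x|]; first exact: derivableM.
apply: (@eq_Ck _ _ (fun x => f x * 'D_v g x + g x * 'D_v f x)) => [x|].
  by rewrite deriveM.
by apply: CkD; apply: IHk => //; exact: CkW.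
Qed.

Lemma CkV V k (f : V -> R) :
  (forall x, f x != 0) -> Ck k f -> Ck k (fun x => (f x)^-1).
Proof.
move=> f0; elim: k => [|k IHk]; first by move=> cf x; apply: cvgV; [exact: f0|exact: cf].
move=> Cf; have [cf df] := Cf.
split=> [x|v]; first by apply: cvgV; [exact: f0|exact: cf].
have [dfv Dfv] := df v; have CV := IHk (CkW Cf).
split=> [x|]; first exact: derivableV.
apply: (@eq_Ck _ _ (fun x => (-1 * ((f x)^-1 * (f x)^-1)) * 'D_v f x)) => [x|].
  by rewrite deriveV// expr2 invfM mulN1r.
by apply: CkM => //; apply: CkM; [exact: Ck_cst|exact: CkM].
Qed.

Lemma Ck_prod V k (I : Type) (s : seq I) (f : I -> V -> R) :
  (forall i, Ck k (f i)) -> Ck k (fun x => \prod_(i <- s) f i x).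
Proof.
move=> Cf; elim: s => [|i s IHs].
  by apply: (eq_Ck _ (@Ck_cst V k 1)) => x; rewrite big_nil.
by apply: (eq_Ck _ (CkM (Cf i) IHs)) => x; rewrite big_cons.
Qed.

Lemma Ck_sum V k (I : Type) (s : seq I) (f : I -> V -> R) :
  (forall i, Ck k (f i)) -> Ck k (fun x => \sum_(i <- s) f i x).
Proof.
move=> Cf; elim: s => [|i s IHs].
  by apply: (eq_Ck _ (@Ck_cst V k 0)) => x; rewrite big_nil.
by apply: (eq_Ck _ (CkD (Cf i) IHs)) => x; rewrite big_cons.
Qed.

(** The difference quotient of [g \o A] along v is literally that of g along [l v] at [A x], so
    derivatives transfer without a chain rule. *)
Lemma Ck_comp_affine V W k (g : W -> R) (A : V -> W) (l : V -> W) :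
  continuous A -> (forall x v (h : R), A (h *: v + x) = h *: l v + A x) ->
  Ck k g -> Ck k (g \o A).
Proof.
move=> cA lA; elim: k g => [|k IHk] g.
  by move=> cg x; apply: continuous_comp; [exact: cA|exact: cg].
move=> [cg dg]; split=> [x|v].
  by apply: continuous_comp; [exact: cA|exact: cg].
have [dgv Dgv] := dg (l v).
have e x : (fun h => h^-1 *: (((g \o A) \o shift x) (h *: v) - (g \o A) x)) =
           (fun h => h^-1 *: ((g \o shift (A x)) (h *: l v) - g (A x))).
  by apply/funext => h /=; rewrite lA.
split=> [x|].
  by rewrite /derivable e; exact: dgv.
by apply: (eq_Ck _ (IHk _ Dgv)) => x; rewrite /= /derive e.
Qed.

Lemma Ck1 k (g g' : R -> R) :
  (forall x : R, is_derive x 1 g (g' x)) -> Ck k g' -> Ck k.+1 g.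
Proof.
move=> dg Cg'; split=> [x|v].
  by apply: differentiable_continuous; apply/derivable1_diffP; have [] := dg x.
have df x : differentiable g x by apply/derivable1_diffP; have [] := dg x.
split=> [x|]; first exact: diff_derivable.
apply: (eq_Ck _ (CkM (@Ck_cst _ k v) Cg')) => x; by rewrite deriveE// diff1E// derive1E derive_val.
Qed.

Lemma smooth_expR : smooth (@expR R).
Proof.
elim=> [|k IHk]; first exact: continuous_expR.
by apply: Ck1 IHk => x; exact: is_derive_expR.
Qed.

Lemma smoothM V (f g : V -> R) : smooth f -> smooth g -> smooth (fun x => f x * g x).
Proof. by move=> Cf Cg k; exact: CkM. Qed.

Lemma smooth_derive V (v : V) (f : V -> R) : smooth f -> smooth (fun x => 'D_v f x).
Proof. by move=> Cf k; have [_ /(_ v)[]] := Cf k.+1. Qed.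

End Ck_theory.

(** * A smooth step function *)

Section step_function.
Variable R : realType.

(** Differentiating exp(-1/x) produces powers of 1/x; with them the family is stable under
    differentiation, and smoothness follows by induction on the order for all [k] at once. *)
Definition flat (k : nat) (x : R) : R :=
  if 0 < x then x^-1 ^+ k * expR (- x^-1) else 0.

Lemma flat_le0 k (x : R) : x <= 0 -> flat k x = 0.
Proof. by rewrite /flat ltNge => ->. Qed.

Lemma flat_ge0 k (x : R) : 0 <= flat k x.
Proof.
rewrite /flat; case: ifPn => // x0.
by rewrite mulr_ge0 ?expR_ge0// exprn_ge0// invr_ge0 ltW.
Qed.

(** Comes from exp y >= y^(k+2) / (k+2)! at y = 1/x. The square on the right makes the derivative at
    0 exist and vanish. *)
Lemma flat_bound k (x : R) : flat k x <= (k.+2)`!%:R * x ^+ 2.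
Proof.
rewrite /flat; case: ifPn => [x0|_]; last by rewrite mulr_ge0// ?sqr_ge0.
have i0 : 0 < x^-1 by rewrite invr_gt0.
rewrite expRN ler_pdivrMr ?expR_gt0//.
have := expR_ge1Dxn k.+1 (ltW i0) => h.
have h2 : x^-1 ^+ k.+2 / k.+2`!%:R <= expR x^-1 by apply: le_trans h; rewrite lerDr.
have F0 : 0 < k.+2`!%:R :> R by rewrite ltr0n fact_gt0.
apply: (@le_trans _ _ (k.+2`!%:R * x ^+ 2 * (x^-1 ^+ k.+2 / k.+2`!%:R))); last first.
  by apply: ler_wpM2l h2; rewrite mulr_ge0 ?sqr_ge0// ltW.
rewrite le_eqVlt; apply/orP; left; apply/eqP.
rewrite -[k.+2]addn2 exprD -[in RHS]addn2.
by field; rewrite !gt_eqF// ?addn2.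
Qed.

Lemma is_derive_flat k (x : R) :
  is_derive x 1 (flat k) (- k%:R * flat k.+1 x + flat k.+2 x).
Proof.
have [x0|x0|->] := ltgtP x 0.
- rewrite !(flat_le0 _ (ltW x0)) mulr0 addr0.
  apply: (@near_eq_is_derive _ _ _ (cst 0)).
  near=> y; rewrite /cst flat_le0// ltW//.
  by near: y; exact: lt_nbhsl.
- have H : is_derive x 1 (fun s : R => s^-1) (- x^-1 ^+ 2).
    apply: is_derive_eq; first by apply: is_deriveV; rewrite ?gt_eqF.
    by rewrite /GRing.scale/= mulr1 exprVn.
  have D : is_derive x 1 (fun y : R => y^-1 ^+ k * expR (- y^-1))
      (- k%:R * flat k.+1 x + flat k.+2 x).
    have D1 : is_derive x 1 (fun y : R => y^-1 ^+ k) (- k%:R * x^-1 ^+ k.+1).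
      have -> : (fun y : R => y^-1 ^+ k) = (fun y : R => y^-1) ^+ k.
        by elim: k => [|j IH]; apply/funext => y; rewrite ?expr0// !exprS fctE -IH.
      have -> : - k%:R * x^-1 ^+ k.+1 = (k%:R * x^-1 ^+ k.-1) *: (- x^-1 ^+ 2).
        by case: k => [|k]; rewrite ?mulr0n -[RHS]/(_ * _) ?mul0r ?oppr0 ?mul0r//= !exprS; ring.
      exact: is_deriveX.
    have D2 : is_derive x 1 (fun y : R => expR (- y^-1)) (expR (- x^-1) * x^-1 ^+ 2).
      have := @is_derive1_comp R expR (fun y : R => - y^-1) x _ _ (is_derive_expR _) (is_deriveN H).
      by rewrite opprK.
    refine (is_derive_eq (is_deriveM D1 D2) _).
    rewrite /flat x0 -[LHS]/(_ * (_ * _) + _ * _) !exprS; ring.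
  apply: near_eq_is_derive D.
  near=> y; rewrite /flat ifT//.
  by near: y; exact: lt_nbhsr.
- rewrite !flat_le0// mulr0 addr0.
  have lim0 : h^-1 *: ((flat k \o shift 0) (h *: 1) - flat k 0)
      @[h --> 0^'] --> (0 : R).
    apply/cvgrPdist_le => e e0.
    have C0 : 0 < (k.+2)`!%:R :> R by rewrite ltr0n fact_gt0.
    near=> h.
    rewrite sub0r normrN (flat_le0 _ (lexx 0)) subr0 /= addr0.
    rewrite [_ *: 1]mulr1 normrM normfV ger0_norm ?flat_ge0// mulrC.
    have hn0 : 0 < `|h| by rewrite normr_gt0; near: h; exact: nbhs_dnbhs_neq.
    rewrite ler_pdivrMr//; apply: le_trans (flat_bound k h) _.
    rewrite -real_normK ?num_real// expr2 mulrA ler_wpM2r// mulrC -ler_pdivlMr//.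
    near: h; apply: dnbhs0_le; rewrite divr_gt0//.
  by apply: DeriveDef; [apply/cvg_ex; exists 0|exact: cvg_lim lim0].
Unshelve. all: by end_near. Qed.

Lemma smooth_flat k : smooth (flat k).
Proof.
move=> j; elim: j k => [|j IHj] k.
  move=> x; apply: differentiable_continuous; apply/derivable1_diffP.
  by have [] := is_derive_flat k x.
apply: Ck1 (is_derive_flat k) _.
by apply: CkD => //; apply: CkM => //; exact: Ck_cst.
Qed.

Definition step (x : R) : R := flat 0 x / (flat 0 x + flat 0 (1 - x)).

Lemma flat_gt0 k (x : R) : 0 < x -> 0 < flat k x.
Proof.
by move=> x0; rewrite /flat x0 mulr_gt0 ?expR_gt0// exprn_gt0// invr_gt0.
Qed.

Let step_denom (x : R) : 0 < flat 0 x + flat 0 (1 - x).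
Proof.
have [x0|x0] := leP x 0.
  by rewrite ltr_wpDl ?flat_ge0// flat_gt0//; lra.
by rewrite ltr_pwDl ?flat_ge0// flat_gt0.
Qed.

Lemma step_le0 (x : R) : x <= 0 -> step x = 0.
Proof. by move=> x0; rewrite /step (flat_le0 _ x0) mul0r. Qed.

Lemma step_ge1 (x : R) : 1 <= x -> step x = 1.
Proof.
move=> x1; have := step_denom x; rewrite /step (@flat_le0 0 (1 - x)) ?subr_le0//.
by rewrite addr0 => h; rewrite divff// gt_eqF.
Qed.

Lemma step_ge0 (x : R) : 0 <= step x.
Proof. by rewrite divr_ge0 ?flat_ge0// ltW. Qed.

Lemma smooth_step : smooth step.
Proof.
move=> k; apply: CkM; first exact: smooth_flat.
apply: CkV => [x|]; first by rewrite gt_eqF.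
apply: CkD; first exact: smooth_flat.
apply: (@Ck_comp_affine R R R k (flat 0) (fun x => 1 - x) -%R).
- by move=> x; apply: cvgB; [exact: cvg_cst|exact: cvg_id].
- by move=> x v h; rewrite scalerN opprD addrCA.
- exact: smooth_flat.
Qed.

End step_function.

(** A directional derivative sees only the values along a line; this moves derivatives between
    space-time, space and the real line. *)
Lemma derive_near_line (R : realType) (V W : normedModType R) (f : V -> R)
    (g : W -> R) (x v : V) (y w : W) :
  (\forall h \near 0, f (h *: v + x) = g (h *: w + y)) -> 'D_v f x = 'D_w g y.
Proof.
move=> fg; have fx : f x = g y.
  by have := nbhs_singleton fg; rewrite !scale0r !add0r.
rewrite /derive; congr (lim _); rewrite eqEsubset.
suff E : \forall h \near 0^', h^-1 *: ((f \o shift x) (h *: v) - f x) =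
    h^-1 *: ((g \o shift y) (h *: w) - g y).
  by split; apply: near_eq_cvg => //; near do apply/esym.
near=> h; congr (_ *: (_ - _)) => //=.
by near: h; exact: nbhs_dnbhs.
Unshelve. all: by end_near. Qed.

(** * Truncated exponentials as test functions *)

Section test_functions.
Context (R : realType) (n : nat).
Implicit Types (w x v : 'rV[R]_n) (L : R).

Definition dotp w x : R := \sum_(i < n) w ord0 i * x ord0 i.

Lemma dotp_affine w x v (h : R) : dotp w (h *: v + x) = h * dotp w v + dotp w x.
Proof.
rewrite /dotp mulr_sumr -big_split/=; apply: eq_bigr => i _.
by rewrite !mxE; ring.
Qed.

Lemma dotp_delta w (i : 'I_n) : dotp w (delta_mx ord0 i) = w ord0 i.
Proof.
rewrite /dotp (bigD1 i)//= mxE !eqxx mulr1 big1 ?addr0// => j ji.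
by rewrite mxE (negbTE ji) andbF mulr0.
Qed.

Lemma continuous_dotp w : continuous (dotp w).
Proof.
apply: (@Ck_sum R 'rV[R]_n 0%N) => i x.
apply: (@continuousM R 'rV[R]_n (cst (w ord0 i)) (fun y => y ord0 i)).
  exact: cst_continuous.
exact: coord_continuous.
Qed.

Definition expdot w x : R := expR (dotp w x).

Lemma smooth_expdot w : smooth (expdot w).
Proof.
move=> k; apply: (@Ck_comp_affine R _ R k expR (dotp w) (dotp w)).
- exact: continuous_dotp.
- by move=> *; rewrite dotp_affine.
- exact: smooth_expR.
Qed.

Lemma derive_expdot w x v : 'D_v (expdot w) x = dotp w v * expdot w x.
Proof.
transitivity ('D_(dotp w v) (@expR R) (dotp w x)).
  by apply: derive_near_line; near=> h; rewrite /expdot dotp_affine.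
have df : differentiable (@expR R) (dotp w x) by exact/derivable1_diffP.
by rewrite deriveE// diff1E// derive1E derive_val.
Unshelve. all: by end_near. Qed.

Definition cutoff L (y : R) : R := step (L + 1 - y) * step (L + 1 + y).

Lemma cutoff_le L y : `|y| <= L -> cutoff L y = 1.
Proof. by rewrite ler_norml => yL; rewrite /cutoff !step_ge1 ?mul1r//; lra. Qed.

Lemma cutoff_ge L y : L + 1 <= `|y| -> cutoff L y = 0.
Proof.
by rewrite ler_normr /cutoff => /orP[] yL;
  [rewrite step_le0 ?mul0r//|rewrite (@step_le0 _ (L + 1 + y)) ?mulr0//]; lra.
Qed.

Lemma cutoff_ge0 L y : 0 <= cutoff L y.
Proof. by rewrite mulr_ge0// step_ge0. Qed.

Lemma smooth_cutoff L : smooth (cutoff L).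
Proof.
move=> k; apply: CkM.
  apply: (@Ck_comp_affine R R R k (@step R) (fun y => L + 1 - y) -%R).
  - by move=> x; apply: cvgB; [exact: cvg_cst|exact: cvg_id].
  - by move=> x v h; rewrite scalerN opprD addrCA.
  - exact: smooth_step.
apply: (@Ck_comp_affine R R R k (@step R) (fun y => L + 1 + y) id).
- by move=> x; apply: cvgD; [exact: cvg_cst|exact: cvg_id].
- by move=> x v h; rewrite addrCA.
- exact: smooth_step.
Qed.

(** Compactly supported substitute for exp(w.x), equal to it on the box of half-side [L], which will
    contain the support of u up to a fixed time. *)
Definition expcut L w x : R := expdot w x * \prod_(i < n) cutoff L (x ord0 i).

Lemma smooth_expcut L w : smooth (expcut L w).
Proof.
apply: smoothM; first exact: smooth_expdot.
move=> k; apply: Ck_prod => i.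
apply: (@Ck_comp_affine R _ R k (cutoff L) (fun x => x ord0 i) (fun x => x ord0 i)).
- exact: coord_continuous.
- by move=> x v h; rewrite !mxE.
- exact: smooth_cutoff.
Qed.

Lemma expcut_ge0 L w x : 0 <= expcut L w x.
Proof. by rewrite mulr_ge0 ?expR_ge0// prodr_ge0// => i _; exact: cutoff_ge0. Qed.

Lemma expcut_eq L w x : (forall i, `|x ord0 i| <= L) -> expcut L w x = expdot w x.
Proof.
move=> xL; rewrite /expcut big1 ?mulr1// => i _; exact: cutoff_le.
Qed.

Definition box L : set 'rV[R]_n := [set x | forall i, `[- L, L]%classic (x ord0 i)].

Lemma compact_box L : compact (box L).
Proof. apply: (@rV_compact _ _ (fun=> `[- L, L]%classic)) => _; exact: segment_compact. Qed.

Lemma closed_box L : closed (box L).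
Proof.
apply: compact_closed; last exact: compact_box.
exact: norm_hausdorff.
Qed.

Lemma expcut_neq0 L w x : expcut L w x != 0 -> box (L + 1) x.
Proof.
apply: contra_neqP => /existsNP[i xi].
rewrite /expcut (bigD1 i)//= cutoff_ge ?mul0r ?mulr0//.
rewrite leNgt; apply/negP => xiL; apply: xi.
by rewrite /= in_itv/= -ler_norml ltW.
Qed.

Lemma supp_subset (V : normedModType R) (f : V -> R) (K : set V) :
  closed K -> (forall y, f y != 0 -> K y) -> supp f `<=` K.
Proof.
move=> cK fK; rewrite /supp; move/closure_id : cK => ->.
by apply: closureS => x; exact: fK.
Qed.

Lemma compact_supp (V : normedModType R) (f : V -> R) (K : set V) :
  compact K -> closed K -> (forall y, f y != 0 -> K y) -> compact (supp f).
Proof.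
move=> cK clK fK; apply: subclosed_compact cK (supp_subset clK fK).
exact: closed_closure.
Qed.

Lemma test_function_expcut L w : test_function (expcut L w).
Proof.
split; first exact: smooth_expcut.
apply: (@compact_supp _ _ (box (L + 1))); [exact: compact_box|exact: closed_box|].
by move=> x; exact: expcut_neq0.
Qed.

Lemma test_function_derive (V : normedModType R) (v : V) (f : V -> R) :
  test_function f -> test_function (fun y => 'D_v f y).
Proof.
move=> [Sf cf]; split; first exact: smooth_derive.
apply: (compact_supp cf); first exact: closed_closure.
move=> x; apply: contra_neqP => nsx.
have /open_nbhs_nbhs : open_nbhs x (~` supp f).
  by split => //; exact/closed_openC/closed_closure.
move=> nx; rewrite (@near_eq_derive _ _ _ f (cst 0)) ?derive_cst//.
apply: filterS nx => y /= nsy; apply: contrapT => /eqP fy; apply: nsy.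
exact: subset_closure.
Qed.

Lemma near_box L x : (forall i, `|x ord0 i| < L) ->
  \forall y \near x, forall i, `|(y : 'rV[R]_n) ord0 i| < L.
Proof.
move=> xL; exists (fun _ _ => [set y : R | `|y| < L]) => [i j|y /= yL i].
  have /cvgr_lt := @norm_continuous R R (x i j).
  by rewrite (ord1 i); apply.
exact: yL.
Qed.

Lemma derive_expcut L w x v : (forall i, `|x ord0 i| < L) ->
  'D_v (expcut L w) x = dotp w v * expdot w x.
Proof.
move=> xL; rewrite -derive_expdot; apply: near_eq_derive.
apply: filterS (near_box xL) => y yL; apply: expcut_eq => i; exact/ltW.
Qed.

Lemma derive2_expcut L w x v : (forall i, `|x ord0 i| < L) ->
  'D_v (fun y => 'D_v (expcut L w) y) x = dotp w v ^+ 2 * expdot w x.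
Proof.
move=> xL; rewrite (@near_eq_derive _ _ _ _ (dotp w v *: expdot w)); last first.
  by apply: filterS (near_box xL) => y yL; rewrite derive_expcut.
have df : derivable (expdot w) x v by have [_ /(_ v)[]] := smooth_expdot w 1%N.
by rewrite deriveZ// derive_expdot -[LHS]/(_ * (_ * _)) mulrA expr2.
Qed.

Variables (b d : R).
Hypothesis d0 : 0 < d.

(** Equal to 1 on [-1, b + d], a neighbourhood of [0, b], so that its derivative vanishes on [0, b],
    endpoints included. It vanishes after b + 2 d, a time to be taken before T, and before -2, since
    test functions are defined at negative times too. *)
Definition timecut (t : R) : R := step ((b + 2 * d - t) / d) * step (t + 2).

Lemma timecut_eq1 t : -1 <= t -> t <= b + d -> timecut t = 1.
Proof.
move=> t1 tb; have d_gt0 := d0; rewrite /timecut !step_ge1 ?mulr1//; first lra.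
by rewrite ler_pdivlMr//; lra.
Qed.

Lemma timecut_neq0 t : timecut t != 0 -> `[-2, b + 2 * d]%classic t.
Proof.
apply: contra_neqP; rewrite /= in_itv/= => /negP; rewrite negb_and -!ltNge => /orP[] tb.
  by rewrite /timecut (@step_le0 _ (t + 2)) ?mulr0//; lra.
rewrite /timecut step_le0 ?mul0r// pmulr_lle0 ?invr_gt0//; lra.
Qed.

Lemma timecut_ge0 t : 0 <= timecut t.
Proof. by rewrite mulr_ge0// step_ge0. Qed.

Lemma smooth_timecut : smooth timecut.
Proof.
move=> k; apply: CkM.
  apply: (@Ck_comp_affine R R R k (@step R) (fun y => (b + 2 * d - y) / d) (fun y => - y / d)).
  - move=> x; apply: cvgM; last exact: cvg_cst.
    by apply: cvgB; [exact: cvg_cst|exact: cvg_id].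
  - by move=> x v h; rewrite /GRing.scale/=; ring.
  - exact: smooth_step.
apply: (@Ck_comp_affine R R R k (@step R) (fun y => y + 2) id).
- by move=> x; apply: cvgD; [exact: cvg_id|exact: cvg_cst].
- by move=> x v h; rewrite -addrA.
- exact: smooth_step.
Qed.

Definition stcut L w (z : spacetime R n) : R := timecut z.1 * expcut L w z.2.

Lemma smooth_stcut L w : smooth (stcut L w).
Proof.
apply: smoothM => k.
  apply: (@Ck_comp_affine R (spacetime R n) R k timecut fst fst) => //.
  - by move=> x; exact: cvg_fst.
  - exact: smooth_timecut.
apply: (@Ck_comp_affine R (spacetime R n) 'rV[R]_n k (expcut L w) snd snd) => //.
- by move=> x; exact: cvg_snd.
- exact: smooth_expcut.
Qed.

Lemma stcut_eq L w t x : -1 <= t -> t <= b + d -> stcut L w (t, x) = expcut L w x.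
Proof. by move=> t1 tb; rewrite /stcut/= timecut_eq1// mul1r. Qed.

Lemma stcut_ge0 L w z : 0 <= stcut L w z.
Proof. by rewrite mulr_ge0 ?timecut_ge0 ?expcut_ge0. Qed.

Lemma test_function_stcut L w (T : \bar R) : ((b + 2 * d)%:E < T)%E ->
  spacetime_test_function T (stcut L w).
Proof.
move=> bT.
pose K : set (spacetime R n) := (`[-2, b + 2 * d]%classic : set R^o) `*` box (L + 1).
have cK : compact K by apply: compact_setX; [exact: segment_compact|exact: compact_box].
have clK : closed K by apply: compact_closed cK; exact: norm_hausdorff.
have nK z : stcut L w z != 0 -> K z.
  rewrite mulf_eq0 negb_or => /andP[z1 z2].
  by split; [exact: timecut_neq0|exact: expcut_neq0 z2].
split; first by split; [exact: smooth_stcut|exact: compact_supp nK].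
apply: subset_trans (supp_subset clK nK) _ => -[t x] [/= + _].
by rewrite in_itv/= => /andP[_ tb]; apply: le_lt_trans bT; rewrite lee_fin.
Qed.

Lemma dt_stcut L w t x : 0 <= t -> t <= b -> dt (stcut L w) (t, x) = 0.
Proof.
have d_gt0 := d0.
move=> t0 tb; rewrite /dt.
rewrite -(@derive_cst R R R (expcut L w x) 0 1); apply: derive_near_line.
near=> h; rewrite /cst.
have -> : h *: ((1, 0) : spacetime R n) + (t, x) = (h + t, x).
  by congr pair => /=; rewrite ?scaler0 ?add0r//; congr (_ + _); exact: mulr1.
have : `|h| < Num.min 1 d.
  near: h; apply: (@nbhs0_lt R R); by rewrite lt_min d0 ltr01.
rewrite lt_min !ltr_norml => /andP[/andP[? ?] /andP[? ?]].
by apply: stcut_eq; lra.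
Unshelve. all: by end_near. Qed.

Lemma dx_stcut L w (i : 'I_n) t x : 0 <= t -> t <= b ->
  dx i (stcut L w) (t, x) = 'D_(delta_mx ord0 i) (expcut L w) x.
Proof.
have d_gt0 := d0.
move=> t0 tb; apply: derive_near_line; near=> h.
have -> : h *: ((0, delta_mx ord0 i) : spacetime R n) + (t, x) =
    (t, h *: delta_mx ord0 i + x).
  by congr pair => /=; rewrite scaler0 add0r.
by rewrite stcut_eq//; lra.
Unshelve. all: by end_near. Qed.

End test_functions.

(** * Lebesgue integral on R^n *)

Section measure_rV.
Context (R : realType).

(** A countable base of the topology. It serves twice: open sets are measurable for the coordinate
    sigma-algebra, and a support condition reduces to countably many null sets. *)
Definition ratbox (n : nat) (q : 'rV[rat]_n * 'rV[rat]_n) : set 'rV[R]_n :=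
  [set x | forall i, `]ratr (q.1 ord0 i), ratr (q.2 ord0 i)[%classic (x ord0 i)].

Lemma measurable_ratbox (n : nat) (q : 'rV[rat]_n * 'rV[rat]_n) :
  measurable (ratbox q).
Proof.
rewrite (_ : ratbox q = \bigcap_(i in [set: 'I_n])
    (@rV_coord R n i @^-1` `]ratr (q.1 ord0 i), ratr (q.2 ord0 i)[%classic)).
  apply: fin_bigcap_measurable => // i _.
  rewrite -[X in measurable X]setTI.
  by apply: measurable_rV_coord => //; exact: measurable_itv.
by apply/seteqP; split => v /= Av i; [move=> _|]; exact: Av.
Qed.

Lemma ratbox_base (n : nat) (U : set 'rV[R]_n) (x : 'rV[R]_n) :
  nbhs x U -> exists2 q, ratbox q x & ratbox q `<=` U.
Proof.
move=> /nbhs_ballP[e /= e0 xeU].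
have /fin_all_exists[a aP] (i : 'I_n) : exists a : rat,
    ratr a \in `]x ord0 i - e, x ord0 i[.
  by have [a] := @rat_in_itvoo R (x ord0 i - e) (x ord0 i) (ltac:(lra)); exists a.
have /fin_all_exists[b bP] (i : 'I_n) : exists b : rat,
    ratr b \in `]x ord0 i, x ord0 i + e[.
  by have [b] := @rat_in_itvoo R (x ord0 i) (x ord0 i + e) (ltac:(lra)); exists b.
exists (\row_i a i, \row_i b i) => [i|y yq].
  rewrite /= !mxE in_itv/=.
  by move: (aP i) (bP i); rewrite !in_itv/= => /andP[_ ->] /andP[->].
apply: xeU; split => // i j; rewrite (ord1 i) /ball/= ltr_norml.
have := yq j; rewrite /= !mxE in_itv/=.
by move: (aP j) (bP j); rewrite !in_itv/= => /andP[? ?] /andP[? ?] /andP[? ?]; lra.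
Qed.

Lemma open_measurable_rV (n : nat) (U : set 'rV[R]_n) : open U -> measurable U.
Proof.
move=> oU.
rewrite (_ : U = \bigcup_(q : 'rV[rat]_n * 'rV[rat]_n)
    if `[< ratbox q `<=` U >] then ratbox q else set0).
  apply: countable_bigcupT_measurable; first exact: countableP.
  by move=> q; case: ifPn => // _; exact: measurable_ratbox.
apply/seteqP; split => [x Ux|x [q _]].
  have [q qx qU] := ratbox_base (open_nbhs_nbhs (conj oU Ux)).
  by exists q => //; rewrite ifT//; exact/asboolP.
by case: ifPn => // /asboolP; exact.
Qed.

Lemma continuous_measurable_rV (n : nat) (f : 'rV[R]_n -> R) :
  continuous f -> measurable_fun setT f.
Proof.
move=> /continuousP cf; apply: (measurability _ (RGenOpens.measurableE R)).
move=> _ [_ [a [b ->] <-]]; rewrite setTI.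
by apply: open_measurable_rV; apply: cf; exact: itv_open.
Qed.

Lemma ge0_integral_rVS (n : nat) (f : 'rV[R]_n.+1 -> \bar R) :
  measurable_fun setT f -> (forall x, 0 <= f x)%E ->
  (\int[lebesgue_rV R n.+1]_x f x =
   \int[lebesgue_rV R n]_x \int[@lebesgue_measure R]_a f (rV_cons (a, x)))%E.
Proof.
move=> mf f0.
rewrite -(@fubini_tonelli2 _ _ _ _ R (@lebesgue_measure R) (lebesgue_rV R n)
  (f \o @rV_cons R n)); last 2 first.
- by apply: measurableT_comp => //; exact: measurable_rV_cons.
- by move=> z; exact: f0.
have := @ge0_integral_pushforward _ _ _ _ R (@rV_cons R n)
  (@measurable_rV_cons R n) (@lebesgue_measure R \x lebesgue_rV R n)%E setT f
  measurableT mf (fun x _ => f0 x).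
by rewrite preimage_setT.
Qed.

End measure_rV.

(** * Plane waves on balls *)

Section plane_waves.
Context (R : realType).

Lemma rV_cons0 (n : nat) (a : R) (x : 'rV[R]_n) : rV_cons (a, x) ord0 ord0 = a.
Proof.
rewrite /rV_cons (_ : ord0 = @lshift 1 n ord0); last exact: val_inj.
by rewrite (@row_mxEl _ 1 1 n) mxE.
Qed.

Lemma rV_consS (n : nat) (a : R) (x : 'rV[R]_n) (i : 'I_n) :
  rV_cons (a, x) ord0 (lift ord0 i) = x ord0 i.
Proof.
rewrite /rV_cons (_ : lift ord0 i = @rshift 1 n i); last exact: val_inj.
by rewrite (@row_mxEr _ 1 1 n).
Qed.

Lemma ge0_integral_tensor (n : nat) (g : 'I_n -> R -> R) :
  (forall i, measurable_fun setT (g i)) -> (forall i y, 0 <= g i y) ->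
  (\int[lebesgue_rV R n]_x (\prod_(i < n) g i (x ord0 i))%:E =
   \prod_(i < n) \int[@lebesgue_measure R]_y (g i y)%:E)%E.
Proof.
elim: n g => [|n IHn] g mg g0.
  rewrite big_ord0 /= integral_dirac// ?diracT ?mul1e; first by rewrite big_ord0.
  by rewrite (_ : (fun _ => _) = cst 1%E)//; apply/funext => x; rewrite big_ord0.
have mcoord (i : 'I_n.+1) : measurable_fun setT (fun x : 'rV[R]_n.+1 => g i (x ord0 i)).
  exact: (measurableT_comp (mg i) (measurable_rV_coord i)).
have mcoord' (i : 'I_n) : measurable_fun setT (fun x : 'rV[R]_n => g (lift ord0 i) (x ord0 i)).
  exact: (measurableT_comp (mg (lift ord0 i)) (measurable_rV_coord i)).
rewrite ge0_integral_rVS; last 2 first.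
- by apply/measurable_EFinP; exact: measurable_prod.
- by move=> x; rewrite lee_fin prodr_ge0.
under eq_integral => x _.
  under eq_integral => a _.
    rewrite big_ord_recl rV_cons0 mulrC EFinM.
    under eq_bigr do rewrite rV_consS.
    over.
  rewrite ge0_integralZl_EFin//; last 3 first.
  - by move=> a _; rewrite lee_fin.
  - by apply/measurable_EFinP; exact: (mg ord0).
  - by rewrite prodr_ge0.
  over.
rewrite ge0_integralZr//; last 3 first.
- by apply/measurable_EFinP; exact: measurable_prod.
- by move=> x _; rewrite lee_fin prodr_ge0.
- by apply: integral_ge0 => a _; rewrite lee_fin.
by rewrite (IHn (fun i => g (lift ord0 i)))// big_ord_recl muleC.
Qed.

Lemma integral_gauss (c s : R) : 0 < s ->
  (\int[@lebesgue_measure R]_y (expR (- (y - c) ^+ 2 / (4 * s)))%:E =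
   (Num.sqrt (4 * pi * s))%:E)%E.
Proof.
(* Standard deviation of the normal law whose exponent has denominator 2 sg^2 = 4 s. *)
move=> s0; pose sg : R := Num.sqrt (2 * s).
have sg0 : 0 < sg by rewrite sqrtr_gt0 mulr_gt0.
have sg2 : sg ^+ 2 = 2 * s by rewrite sqr_sqrtr// mulr_ge0// ltW.
have p0 : 0 < 4 * pi * s by rewrite !mulr_gt0// pi_gt0.
have peakE : normal_peak sg = (Num.sqrt (4 * pi * s))^-1.
  by rewrite /normal_peak sg2 mulr2n; congr (Num.sqrt _)^-1; ring.
have mf : measurable_fun setT (fun y : R => (expR (- (y - c) ^+ 2 / (4 * s)))%:E).
  apply/measurable_EFinP; apply: continuous_measurable_fun => y.
  apply: continuous_comp; last exact: continuous_expR.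
  apply: cvgM; last exact: cvg_cst.
  by apply: cvgN; apply: cvgM; apply: cvgB; first [exact: cvg_id|exact: cvg_cst].
have := integral_normal_pdf c sg.
under eq_integral => y _.
  rewrite /normal_pdf gt_eqF// EFinM peakE.
  rewrite (_ : normal_fun c sg y = expR (- (y - c) ^+ 2 / (4 * s))); last first.
    by rewrite /normal_fun sg2; congr (expR (_ / _)); rewrite mulr2n; ring.
  over.
rewrite ge0_integralZl_EFin ?invr_ge0 ?sqrtr_ge0// => h.
rewrite -[LHS]mul1e -[1%E](_ : (Num.sqrt (4 * pi * s))%:E * (Num.sqrt (4 * pi * s))^-1%:E = 1)%E.
  by rewrite -muleA h mule1.
by rewrite -EFinM divff// gt_eqF// sqrtr_gt0.
Qed.

Lemma enorm_le (n : nat) (x : 'rV[R]_n) (r : R) : 0 <= r ->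
  (enorm x <= r) = (\sum_(i < n) x ord0 i ^+ 2 <= r ^+ 2).
Proof.
move=> r0; by rewrite /enorm -[r in LHS]ger0_norm// -sqrtr_sqr ler_sqrt// sqr_ge0.
Qed.

Lemma coord_le_enorm (n : nat) (x : 'rV[R]_n) (i : 'I_n) : `|x ord0 i| <= enorm x.
Proof.
rewrite /enorm -sqrtr_sqr ler_sqrt; last by apply: sumr_ge0 => j _; exact: sqr_ge0.
by rewrite (bigD1 i)//= lerDl; apply: sumr_ge0 => j _; exact: sqr_ge0.
Qed.

Lemma measurable_enorm_le (n : nat) (r : R) :
  measurable [set x : 'rV[R]_n | enorm x <= r].
Proof.
have me : measurable_fun setT (@enorm R n).
  apply: (measurableT_comp (continuous_measurable_fun (@sqrt_continuous R))).
  by apply: measurable_sum => i; exact: measurable_funX (measurable_rV_coord i).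
have := me measurableT `]-oo, r]%classic (measurable_itv _).
rewrite setTI (_ : _ @^-1` _ = [set x : 'rV[R]_n | enorm x <= r])//.
Qed.

Lemma measurable_box (n : nat) (r : R) : measurable (@box R n r).
Proof.
rewrite -[box _]setCK; apply: measurableC; apply: open_measurable_rV.
exact/closed_openC/closed_box.
Qed.

Lemma lebesgue_box (n : nat) (r : R) : 0 <= r ->
  lebesgue_rV R n (@box R n r) = ((2 * r) ^+ n)%:E.
Proof.
move=> r0; rewrite (@lebesgue_rV_box R n (fun=> `[- r, r]%classic))//.
have -> : @lebesgue_measure R `[- r, r]%classic = (2 * r)%:E.
  rewrite lebesgue_measure_itv/= lte_fin; case: ltP => [_|r1].
    by rewrite -EFinB; congr (_%:E); ring.
  by congr (_%:E); lra.
by rewrite prodEFin prodr_const card_ord.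
Qed.

Lemma volume_enorm_le (n : nat) (r : R) : 0 <= r ->
  (lebesgue_rV R n [set x | (enorm x <= r)%R] <= ((2 * r) ^+ n)%:E)%E.
Proof.
move=> r0; rewrite -lebesgue_box//; apply: le_measure; rewrite ?inE.
- exact: measurable_enorm_le.
- exact: measurable_box.
- by move=> x /= xr i; rewrite /= in_itv/= -ler_norml (le_trans _ xr)// coord_le_enorm.
Qed.

(** Expand the square and use |x| <= r. To be read as exp(w.x) <= exp(r) exp(-|x - r w|^2 / (2 r)):
    on the ball a plane wave is dominated by a Gaussian of width sqrt r centred at the boundary
    point r w. *)
Lemma dist_sphere (n : nat) (w x : 'rV[R]_n) (r : R) : 0 <= r ->
  \sum_(i < n) w ord0 i ^+ 2 = 1 -> enorm x <= r ->
  \sum_(i < n) (x ord0 i - r * w ord0 i) ^+ 2 <= 2 * r * (r - dotp w x).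
Proof.
move=> r0 w1; rewrite enorm_le// => xr.
have -> : \sum_(i < n) (x ord0 i - r * w ord0 i) ^+ 2 =
    \sum_(i < n) x ord0 i ^+ 2 - 2 * r * dotp w x + r ^+ 2 * \sum_(i < n) w ord0 i ^+ 2.
  rewrite /dotp !mulr_sumr -sumrB -big_split/=; apply: eq_bigr => i _; ring.
rewrite w1; lra.
Qed.

(* Half of the exponent controls the directions orthogonal to [w] through
   [dist_sphere]; the other half makes the first coordinate integrable. *)
Lemma plane_wave_integral (n : nat) (w : 'rV[R]_n.+1) (r : R) : 0 < r ->
  \sum_(i < n.+1) w ord0 i ^+ 2 = 1 -> 2^-1 <= w ord0 ord0 ->
  (\int[lebesgue_rV R n.+1]_(x in [set x | (enorm x <= r)%R]) (expdot w x)%:E <=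
   (4 * Num.sqrt (4 * pi * r) ^+ n * expR r)%:E)%E.
Proof.
move=> r0 w1 wh.
pose b (x : 'rV[R]_n) : R := \sum_(i < n) w ord0 (lift ord0 i) * x ord0 i - r.
pose G (x : 'rV[R]_n) : R := \prod_(i < n)
  expR (- (x ord0 i - r * w ord0 (lift ord0 i)) ^+ 2 / (4 * r)).
pose w0 := w ord0 ord0; have w00 : 0 < w0 by apply: lt_le_trans wh; rewrite invr_gt0.
have G0 x : 0 <= G x by rewrite prodr_ge0// => i _; exact: expR_ge0.
have dE a x : dotp w (rV_cons (a, x)) - r = w0 * a + b x.
  rewrite /dotp big_ord_recl rV_cons0 /b /w0 -addrA; congr (_ + (_ - _)).
  by apply: eq_bigr => i _; rewrite rV_consS.
(* On the ball w.x <= r, that is w0 a + b x <= 0, which bounds the first coordinate a above by - b x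
   / w0. *)
have key a x : enorm (rV_cons (a, x)) <= r ->
    `[- r, - b x / w0]%classic a /\
    expdot w (rV_cons (a, x)) <= expR r * (expR ((w0 * a + b x) / 2) * G x).
  move=> ar; have := dist_sphere (ltW r0) w1 ar; set S := \sum_(i < _) _ => hS.
  have S0 : 0 <= S by apply: sumr_ge0 => i _; exact: sqr_ge0.
  have hd : dotp w (rV_cons (a, x)) <= r.
    have : 0 <= 2 * r * (r - dotp w (rV_cons (a, x))) by exact: le_trans hS.
    by rewrite pmulr_rge0 ?mulr_gt0// subr_ge0.
  have ax := dE a x.
  split.
    rewrite /= in_itv/=; apply/andP; split.
      have := le_trans (coord_le_enorm _ ord0) ar.
      by rewrite rV_cons0 ler_norml => /andP[].
    by rewrite ler_pdivlMr// mulrC; lra.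
  rewrite /expdot -[dotp _ _](subrK r) addrC expRD ler_wpM2l ?expR_ge0//.
  rewrite /G -expR_sum -expRD ler_expR ax.
  rewrite -mulr_suml sumrN.
  move: hS; rewrite /S big_ord_recl; under eq_bigr do rewrite rV_consS.
  set S' := \sum_(i < _) _ => hS.
  have hS' : S' <= 2 * r * (r - dotp w (rV_cons (a, x))).
    by apply: le_trans hS; rewrite lerDr sqr_ge0.
  have : S' / (4 * r) <= (r - dotp w (rV_cons (a, x))) / 2.
    by rewrite ler_pdivrMr ?mulr_gt0//; lra.
  rewrite -opprB ax mulNr; lra.
have mexp : measurable_fun setT (expdot w).
  by apply: continuous_measurable_rV; exact: Ck_continuous (smooth_expdot w 0%N).
have mE : measurable [set x : 'rV[R]_n.+1 | enorm x <= r] by exact: measurable_enorm_le.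
set Ball := [set x | _] in mE *.
have mf : measurable_fun setT ((fun x => (expdot w x)%:E) \_ Ball).
  apply/(measurable_restrictT _ mE); apply: measurable_funTS.
  exact/measurable_EFinP.
have f0 x : (0 <= ((fun x => (expdot w x)%:E) \_ Ball) x)%E.
  by apply: erestrict_ge0 => y _; rewrite lee_fin expR_ge0.
rewrite integral_mkcond ge0_integral_rVS//.
have mG : measurable_fun setT G.
  apply: measurable_prod => i _.
  apply: measurableT_comp; first exact: measurable_expR.
  apply: measurable_funM; last exact: measurable_cst.
  apply: measurableT_comp => //; apply: measurable_funX.
  by apply: measurable_funB; [exact: measurable_rV_coord|exact: measurable_cst].
apply: (@le_trans _ _ (\int[lebesgue_rV R n]_x ((4 * expR r)%:E * (G x)%:E))%E); last first.
  rewrite ge0_integralZl_EFin//; last 2 first.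
  - by move=> x _; rewrite lee_fin.
  - exact/measurable_EFinP.
  rewrite /G (@ge0_integral_tensor n (fun i y => expR (- (y - r * w ord0 (lift ord0 i)) ^+ 2 / (4 * r)))).
  under eq_bigr do rewrite integral_gauss//.
  - by rewrite prodEFin prodr_const card_ord -EFinM lee_fin mulrAC.
  - move=> i; apply: measurableT_comp; first exact: measurable_expR.
    apply: measurable_funM; last exact: measurable_cst.
    apply: measurableT_comp => //; apply: measurable_funX.
    by apply: measurable_funB => //; exact: measurable_cst.
  - by move=> i y; exact: expR_ge0.
apply: ge0_le_integral => //.
- by move=> x _; exact: integral_ge0.
- apply: (@measurable_fun_fubini_tonelli_G _ _ _ _ R (@lebesgue_measure R)
    (_ \o @rV_cons R n)).
    by apply: measurableT_comp => //; exact: measurable_rV_cons.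
  by move=> z; exact: f0.
- by apply: measurable_funeM; exact/measurable_EFinP.
move=> x _.
(* [c] is the upper end of the slice; the minimum with c - 1 keeps the interval nondegenerate for
   the fundamental theorem of calculus, even if the slice is empty. *)
pose c := - b x / w0; pose lo := Num.min (- r) (c - 1).
have loc : lo < c by rewrite /lo gt_min; apply/orP; right; lra.
pose F (a : R) := expR r * G x * (2 / w0) * expR ((w0 * a + b x) / 2).
pose h (a : R) := expR r * (expR ((w0 * a + b x) / 2) * G x).
have dF (a : R) : is_derive a 1 F (h a).
  have d1 : is_derive a 1 (fun a => (w0 * a + b x) / 2) (w0 / 2).
    by apply: is_derive_eq; rewrite /GRing.scale/=; ring.
  have d2 := @is_derive1_comp R expR _ a _ _ (is_derive_expR _) d1.
  refine (is_derive_eq (is_deriveZ (expR r * G x * (2 / w0)) d2) _).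
  by rewrite /h /= -[LHS]/(_ * (_ * _)); field; rewrite gt_eqF.
have cF (a : R) : {for a, continuous F}.
  by apply: differentiable_continuous; apply/derivable1_diffP; have [] := dF a.
have ch : continuous h.
  move=> a; apply: cvgM; first exact: cvg_cst.
  apply: cvgM; last exact: cvg_cst.
  apply: continuous_comp; last exact: continuous_expR.
  apply: cvgM; last exact: cvg_cst.
  by apply: cvgD; [apply: cvgM; [exact: cvg_cst|exact: cvg_id]|exact: cvg_cst].
have mh : measurable_fun setT h by exact: continuous_measurable_fun.
have h0 a : 0 <= h a by rewrite /h !mulr_ge0// expR_ge0.
apply: (@le_trans _ _ (\int[@lebesgue_measure R]_(a in `[lo, c]) (h a)%:E)%E).
  rewrite [leRHS]integral_mkcond; apply: ge0_le_integral => //.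
  - apply: measurableT_comp; first exact: mf.
    apply: (measurableT_comp (@measurable_rV_cons R n)).
    exact: measurable_pair2.
  - apply: (measurable_restrictT _ (measurable_itv `[lo, c])).1.
    by apply: measurable_funTS; exact/measurable_EFinP.
  - move=> a _; rewrite /patch; case: ifPn => [|_]; last first.
      by case: ifPn => // _; rewrite lee_fin.
    rewrite inE => /= /key[aI ae]; rewrite ifT ?lee_fin//.
    rewrite inE; apply: subset_itv aI; rewrite bnd_simp// /lo.
    by rewrite ge_min lexx.
rewrite (@continuous_FTC2 R h F lo c loc); last 3 first.
- exact: continuous_subspaceT.
- split=> [a _||]; first by have [] := dF a.
  + by apply: cvg_at_right_filter; exact: cF.
  + by apply: cvg_at_left_filter; exact: cF.
- by move=> a _; rewrite derive1E; have [] := dF a.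
rewrite -EFinB -EFinM lee_fin.
have F0 : 0 <= F lo by rewrite /F !mulr_ge0 ?expR_ge0// ?invr_ge0 ltW.
have -> : F c = expR r * G x * (2 / w0).
  have e : w0 * c + b x = 0 by rewrite /c; field; rewrite gt_eqF.
  by rewrite /F e mul0r expR0 mulr1.
(* The bound w0 >= 1/2 enters here and produces the constant 4. *)
have w2 : 2 / w0 <= 4 by rewrite ler_pdivrMr//; move: wh; rewrite -/w0; lra.
have : expR r * G x * (2 / w0) <= expR r * G x * 4.
  by rewrite ler_wpM2l// mulr_ge0// expR_ge0.
lra.
Qed.

(** By the mean value theorem each term is at most four times the increment of [atan] over a unit
    interval, because 1 + c^2 <= 4 exp(y^2 / 2) for y <= c <= y + 1. The increments telescope to
    less than pi. *)
Lemma sum_gauss_le (K : nat) (s : R) :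
  \sum_(k < K) expR (- (k%:R - s) ^+ 2 / 2) <= 4 * pi.
Proof.
have incr (y : R) : expR (- y ^+ 2 / 2) <= 4 * (atan (y + 1) - atan y).
  have [||c cab ->] := @MVT R atan (fun x => (1 + x ^+ 2)^-1) y (y + 1).
  - lra.
  - by apply: continuous_subspaceT => x; exact: continuous_atan.
  rewrite (addrC y 1) addrK mulr1 mulNr expRN.
  have c2 : 0 < 1 + c ^+ 2 by rewrite ltr_pwDl// sqr_ge0.
  rewrite ler_pdivlMr// mulrC ler_pdivrMr ?expR_gt0//.
  have := expR_ge1Dx (y ^+ 2 / 2); move: cab; rewrite in_itv/= => /andP[cy cy1] h.
  have d1 : (c - y) ^+ 2 <= 1 by rewrite expr_le1//; lra.
  have := sqr_ge0 (y - (c - y)); rewrite sqrrB.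
  have -> : c ^+ 2 = (y + (c - y)) ^+ 2 by congr (_ ^+ 2); ring.
  rewrite [(y + (c - y)) ^+ 2]sqrrD; lra.
apply: (@le_trans _ _ (\sum_(k < K) 4 * (atan (k.+1%:R - s) - atan (k%:R - s)))).
  apply: ler_sum => k _; apply: le_trans (incr _) _.
  by rewrite -[k.+1%:R]natr1 [k%:R + 1 - s]addrAC.
rewrite -mulr_sumr ler_pM2l//.
rewrite -(big_mkord xpredT (fun k => atan (k.+1%:R - s) - atan (k%:R - s))).
rewrite telescope_sumr//.
have := atan_ltpi2 (K%:R - s); have := atan_gtNpi2 (0%:R - s); lra.
Qed.

(** The directions lift to the sphere a grid of mesh 1/sqrt r in the last n coordinates; the points
    r w are then about sqrt r apart, the width of the Gaussians of [dist_sphere]. The grid fills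
    only a fixed patch around the first axis, which costs a constant factor in the count. On the
    ball the sum of the waves is bounded by a product of n sums as in [sum_gauss_le]. *)
Lemma directions (n : nat) (r : R) : 0 < r ->
  exists (J : finType) (w : J -> 'rV[R]_n.+1), [/\
    forall j, \sum_(i < n.+1) w j ord0 i ^+ 2 = 1,
    forall j, 2^-1 <= w j ord0 ord0,
    forall x, enorm x <= r -> \sum_j expdot (w j) x <= (4 * pi) ^+ n * expR r &
    (Num.sqrt r / (2 * n.+1%:R)) ^+ n <= #|J|%:R].
Proof.
(* [b] bounds the grid coordinates: n b^2 <= 1/4 keeps the first coordinate at least 1/2. *)
move=> r0; pose b : R := (2 * n.+1%:R)^-1; pose q := Num.sqrt r.
have n0 : 0 < n.+1%:R :> R by rewrite ltr0n.
have b0 : 0 < b by rewrite invr_gt0 mulr_gt0.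
have q0 : 0 < q by rewrite sqrtr_gt0.
have q2 : q ^+ 2 = r by rewrite sqr_sqrtr// ltW.
(* The indices 0, ..., K - 1 satisfy j / q <= b, while the successor makes K > b q for the count. *)
pose K := (Num.truncn (b * q)).+1.
have bq0 : 0 <= b * q by rewrite mulr_ge0// ltW.
have /andP[Kle Kgt] := truncn_itv bq0.
pose v (j : {ffun 'I_n -> 'I_K}) (i : 'I_n) : R := (j i)%:R / q.
have v0 j i : 0 <= v j i by rewrite divr_ge0// ltW.
have vb j i : v j i <= b.
  rewrite ler_pdivrMr//; apply: le_trans Kle; rewrite ler_nat.
  by have := ltn_ord (j i); rewrite ltnS.
have vS j : \sum_(i < n) v j i ^+ 2 <= 4^-1.
  apply: (@le_trans _ _ (\sum_(i < n) b ^+ 2)).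
    by apply: ler_sum => i _; rewrite lerXn2r ?nnegrE// ltW.
  rewrite sumr_const card_ord -[_ *+ n]mulr_natl.
  have nb : n%:R * b <= 2^-1.
    by rewrite /b ler_pdivrMr ?mulr_gt0// mulrA mulVf ?mul1r ?ler_nat// pnatr_eq0.
  have bh : b <= 2^-1.
    rewrite /b lef_pV2 ?posrE ?mulr_gt0// ler_peMr// ler1n//.
  have := ler_pM (mulr_ge0 (ler0n R n) (ltW b0)) (ltW b0) nb bh.
  by rewrite expr2 mulrA; lra.
pose w (j : {ffun 'I_n -> 'I_K}) : 'rV[R]_n.+1 :=
  rV_cons (Num.sqrt (1 - \sum_(i < n) v j i ^+ 2), \row_i v j i).
have w0 j : w j ord0 ord0 = Num.sqrt (1 - \sum_(i < n) v j i ^+ 2) by rewrite rV_cons0.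
have wi j (i : 'I_n) : w j ord0 (lift ord0 i) = v j i by rewrite rV_consS mxE.
have w1 j : \sum_(i < n.+1) w j ord0 i ^+ 2 = 1.
  rewrite big_ord_recl w0 sqr_sqrtr; last by have := vS j; lra.
  rewrite [X in _ + X](eq_bigr (fun i => v j i ^+ 2)) ?subrK// => i _.
  by congr (_ ^+ 2); exact: wi.
exists {ffun 'I_n -> 'I_K}, w; split=> //.
- move=> j; rewrite w0 -[2^-1]ger0_norm// -sqrtr_sqr ler_sqrt.
    by have := vS j; lra.
  by have := vS j; lra.
- move=> x xr.
  have bnd j : expdot (w j) x <= expR r *
      \prod_(i < n) expR (- ((j i)%:R - x ord0 (lift ord0 i) / q) ^+ 2 / 2).
    rewrite /expdot -[dotp _ _](subrK r) addrC expRD ler_wpM2l ?expR_ge0//.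
    rewrite -expR_sum ler_expR -mulr_suml sumrN.
    have := dist_sphere (ltW r0) (w1 j) xr.
    rewrite big_ord_recl.
    rewrite [X in _ + X <= _](eq_bigr (fun i => (x ord0 (lift ord0 i) - r * v j i) ^+ 2)); last first.
      by move=> i _; congr ((_ - r * _) ^+ 2); exact: wi.
    set S := \sum_(i < n) _; set S' := \sum_(i < n) _ => hS.
    have -> : S' = S / r.
      rewrite /S /S' mulr_suml; apply: eq_bigr => i _; rewrite /v -q2.
      by field; rewrite gt_eqF.
    have hS' : S <= 2 * r * (r - dotp (w j) x).
      by apply: le_trans hS; rewrite lerDr sqr_ge0.
    have : S / r <= 2 * (r - dotp (w j) x) by rewrite ler_pdivrMr//; lra.
    rewrite mulNr; lra.
  apply: (le_trans (ler_sum _ (fun j _ => bnd j))).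
  rewrite -mulr_sumr mulrC ler_wpM2r ?expR_ge0//.
  rewrite -(bigA_distr_bigA (fun i (k : 'I_K) =>
    expR (- (k%:R - x ord0 (lift ord0 i) / q) ^+ 2 / 2))).
  rewrite -[n in leRHS]card_ord -prodr_const.
  apply: ler_prod => i _; rewrite sum_gauss_le andbT.
  by apply: sumr_ge0 => k _; exact: expR_ge0.
- rewrite card_ffun !card_ord natrX; apply: lerXn2r; rewrite ?nnegrE//.
  by rewrite -/q -/b mulrC ltW.
Qed.

End plane_waves.

(** * Lower integrals and square-integrable functions *)

Import HBNNSimple.

Section lower_integral.
Context d (T : measurableType d) (R : realType) (mu : {measure set T -> \bar R}).
Local Open Scope ereal_scope.

(* No measurability is assumed below: the library integral of a nonnegative
   function is its lower integral. *)
Lemma le_lower_integral (f g : T -> \bar R) : (forall x, 0 <= f x) ->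
  (forall x, f x <= g x) -> \int[mu]_x f x <= \int[mu]_x g x.
Proof.
move=> f0 fg; rewrite !ge0_integralTE//; last by move=> x; exact: le_trans (fg x).
apply: ge_ereal_sup => _ [h /= hf <-]; apply: ereal_sup_ubound.
by exists h => // x; exact: le_trans (fg x).
Qed.

(** A simple function h below f is nonpositive on [A], so h + k 1_A is below g. The case where g has
    infinite integral is set apart, so that k mu(A) is finite and can be subtracted. *)
Lemma lower_integralD (f g : T -> \bar R) (k : R) (A : set T) : measurable A ->
  (0 <= k)%R -> (forall x, 0 <= f x) -> (forall x, A x -> f x = 0) ->
  (forall x, f x <= g x) -> (forall x, A x -> k%:E <= g x) ->
  \int[mu]_x f x + k%:E * mu A <= \int[mu]_x g x.
Proof.
move=> mA k0 f0 fA fg kg.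
have g0 x : 0 <= g x by exact: le_trans (fg x).
rewrite [X in X + _]ge0_integralTE//.
have [->|goo] := eqVneq (\int[mu]_x g x) +oo; first by rewrite leey.
have kA : k%:E * mu A = \int[mu]_x (k * \1_A x)%:E.
  under eq_integral do rewrite EFinM.
  have m1 : measurable_fun setT (fun x : T => (\1_A x : R)%:E) by exact/measurable_EFinP.
  have p1 (x : T) : setT x -> 0 <= (\1_A x : R)%:E by rewrite lee_fin.
  by rewrite (ge0_integralZl_EFin mu measurableT p1 m1 k0) integral_indic// setIT.
have kAfin : k%:E * mu A \is a fin_num.
  rewrite ge0_fin_numE; last by rewrite mule_ge0// lee_fin.
  rewrite kA; apply: (@le_lt_trans _ _ (\int[mu]_x g x)).
    apply: le_lower_integral => x; first by rewrite lee_fin mulr_ge0.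
    rewrite indicE; case: (boolP (x \in A)) => [/set_mem/kg|_].
      by rewrite mulr1.
    by rewrite mulr0.
  by rewrite lt_neqAle goo leey.
rewrite -leeBrDr//; apply: ge_ereal_sup => _ [h /= hf <-].
rewrite leeBrDr// -integralT_nnsfun kA.
rewrite -ge0_integralD//; last 4 first.
- by move=> x _; rewrite lee_fin.
- exact/measurable_EFinP.
- by move=> x _; rewrite lee_fin mulr_ge0.
- by apply/measurable_EFinP; exact: measurable_funM.
apply: le_lower_integral => x; first by rewrite adde_ge0// lee_fin// mulr_ge0.
rewrite indicE; case: (boolP (x \in A)) => [/set_mem Ax|_]; last first.
  by rewrite mulr0 adde0; exact: le_trans (fg x).
have h0 : (h x)%:E <= 0 by rewrite -(fA x Ax).
by rewrite mulr1; apply: le_trans (kg x Ax); rewrite -[leRHS]add0e leeD2r.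
Qed.

End lower_integral.

Lemma lower_integral_itv (R : realType) (H : R -> \bar R) (x y k : R) :
  (forall s, 0 <= H s)%E -> 0 <= x -> x <= y -> 0 <= k ->
  (forall s, x <= s <= y -> (k%:E <= H s)%E) ->
  (\int[@lebesgue_measure R]_(s in `[0%R, x]) H s + (k * (y - x))%:E <=
   \int[@lebesgue_measure R]_(s in `[0%R, y]) H s)%E.
Proof.
move=> H0 x0 xy k0 kH.
have muA : @lebesgue_measure R `]x, y]%classic = (y - x)%:E.
  rewrite lebesgue_measure_itv/= lte_fin; case: ltP => [_|yx]; first by rewrite EFinB.
  by congr (_%:E); lra.
rewrite EFinM -muA integral_mkcond [leRHS]integral_mkcond.
apply: lower_integralD => //.
- by move=> s; apply: erestrict_ge0.
- move=> s /=; rewrite in_itv/= => /andP[xs _]; rewrite patchE ifF//.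
  by apply/negbTE; rewrite notin_setE/= in_itv/= => /andP[_]; rewrite leNgt xs.
- move=> s; rewrite !patchE; case: ifPn => [|_]; last by case: ifPn.
  rewrite !inE/= => sx; rewrite ifT// inE/=; move: sx; rewrite !in_itv/= => /andP[-> sx].
  exact: le_trans xy.
- move=> s /=; rewrite in_itv/= => /andP[xs sy]; rewrite patchE ifT.
    by apply: kH; rewrite sy ltW.
  by rewrite inE/= in_itv/= sy (le_trans x0)// ltW.
Qed.

(** * Square-integrable functions *)

Section L2_lemmas.
Context (R : realType) (n : nat).
Local Notation leb := (lebesgue_rV R n).
Implicit Types (f g : 'rV[R]_n -> R).

Lemma L2_measurable f : L2 f -> measurable_fun setT f.
Proof. by rewrite /L2 inE => /andP[]; rewrite inE. Qed.

Lemma L2_integrableM f g : L2 f -> L2 g ->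
  leb.-integrable setT (fun x => (f x * g x)%:E).
Proof. by move=> f2 g2; exact/Lfun1_integrable/Lfun2_mul_Lfun1. Qed.

Lemma L2norm_fin f : L2 f -> L2norm f \is a fin_num.
Proof.
rewrite /L2 inE => /andP[_]; rewrite inE/= => f2.
by rewrite ge0_fin_numE// Lnorm_ge0.
Qed.

Lemma L2B f g : L2 f -> L2 g -> L2 (fun x => f x - g x).
Proof.
move=> f2 g2; have p2 : (1 <= 2%:E :> \bar R)%E by rewrite lee1n.
exact: (@rpredB _ (Lfun leb 2%:E) (f : 'rV[R]_n -> R) g).
Qed.

Lemma L2Z (c : R) f : L2 f -> L2 (fun x => f x * c).
Proof. by move=> f2; apply: (@Lfun_scale _ _ _ leb f c 2) => //; rewrite ler1n. Qed.

Lemma cauchy_schwarz f g : L2 f -> L2 g ->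
  (`|\int[leb]_x (f x * g x)|%:E <= L2norm f * L2norm g)%E.
Proof.
move=> f2 g2; have mf := L2_measurable f2; have mg := L2_measurable g2.
have ifg := L2_integrableM f2 g2.
rewrite EFin_normr_Rintegral//.
apply: le_trans (le_abse_integral _ _ _) _ => //; first by case/integrableP : ifg.
have := @hoelder _ _ _ leb f g 2 2 mf mg ltac:(by []) ltac:(by []).
rewrite Lnorm1 => /(_ _)/le_trans; apply; last by [].
by rewrite [RHS]splitr !div1r.
Qed.

Lemma continuous_compact_L2 f (K : R) : continuous f ->
  (forall x, f x != 0 -> box K x) -> L2 f.
Proof.
move=> cf fK.
have mf : measurable_fun setT f by exact: continuous_measurable_rV.
have [M [_ MP]] : bounded_set (f @` box K).
  apply: compact_bounded; apply: continuous_compact; last exact: compact_box.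
  exact: continuous_subspaceT.
pose C : R := `|M| + 1.
have fC x : `|f x| <= C * \1_(box K) x.
  rewrite indicE; case: (boolP (x \in box K)) => [/set_mem xK|/negP xK].
    rewrite mulr1; apply: (MP C); last by exists x.
    by rewrite /C; have := ler_norm M; lra.
  rewrite mulr0 normr_le0; apply: contraT => /fK xK'.
  by exfalso; apply: xK; exact: mem_set.
have mbox := @measurable_box R n K.
rewrite /L2 inE; apply/andP; split; first by rewrite inE.
rewrite inE/= /finite_norm unlock; apply: poweR_lty.
have C0 : 0 <= C ^+ 2 by exact: sqr_ge0.
have mI : measurable_fun setT (fun x : 'rV[R]_n => (\1_(box K) x : R)%:E).
  exact/measurable_EFinP.
have I0 (x : 'rV[R]_n) : setT x -> (0 <= (\1_(box K) x : R)%:E)%E by rewrite lee_fin.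
apply: (@le_lt_trans _ _ (\int[leb]_x ((C ^+ 2)%:E * (\1_(box K) x)%:E))%E).
  under eq_integral => x _ do rewrite poweR_EFin powR_mulrn ?normr_ge0//.
  apply: ge0_le_integral => //.
  - apply/measurable_EFinP; apply: measurable_funX.
    exact: measurableT_comp mf.
  - by apply: measurable_funeM.
  - move=> x _; rewrite -EFinM lee_fin.
    have -> : C ^+ 2 * \1_(box K) x = (C * \1_(box K) x) ^+ 2.
      by rewrite exprMn indicE; case: (x \in _); rewrite ?expr1n ?expr0n.
    by rewrite lerXn2r ?nnegrE//; exact: le_trans (fC x).
rewrite (ge0_integralZl_EFin leb measurableT I0 mI C0) integral_indic// setIT.
have K0 : 0 <= `|K| by [].
rewrite lte_mul_pinfty//; apply: (@le_lt_trans _ _ (leb (box `|K|))).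
  apply: le_measure; rewrite ?inE//.
  - exact: measurable_box.
  - move=> x xK i; have := xK i; rewrite /= !in_itv/=.
    by have := ler_norm K => KK /andP[? ?]; apply/andP; split; lra.
by rewrite lebesgue_box// ltry.
Qed.

End L2_lemmas.

Lemma powR_within_continuous (R : realType) (a b : R) : 0 < a ->
  {within `[0, b], continuous (fun x : R => x `^ a)}.
Proof.
move=> a0; apply/subspace_continuousP => x /=; rewrite in_itv/= => /andP[x0 xb].
move: x0; rewrite le_eqVlt => /predU1P[<-|x0]; last first.
  apply: cvg_within_filter; apply: differentiable_continuous.
  by apply/derivable1_diffP; have [] := is_derive1_powR a x0.
apply/cvgrPdist_lt => e e0; rewrite near_withinE; near=> y => /=.
rewrite /from_subspace in_itv/= => /andP[y0 yb].
rewrite powR0 ?gt_eqF// sub0r normrN.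
rewrite ger0_norm ?powR_ge0// -[ltRHS]powRr1 ?ltW// -(mulVf (lt0r_neq0 a0)) powRrM.
apply: gt0_ltr_powR; rewrite ?nnegrE ?powR_ge0//.
by near: y; apply: lt_nbhsl; rewrite powR_gt0.
Unshelve. all: by end_near. Qed.

Lemma ae_countable d (T : measurableType d) (R : realType)
    (mu : {measure set T -> \bar R}) (I : countType) (P : I -> T -> Prop) :
  (forall i, \forall x \ae mu, P i x) -> \forall x \ae mu, forall i, P i x.
Proof.
move=> aeP.
have : \forall x \ae mu, forall k, if (unpickle k : option I) is Some i then P i x else True.
  apply: ae_foralln => k; case: (unpickle k) => [i|]; first exact: aeP.
  exact: aeW.
by apply: filterS => x xP i; have := xP (pickle i); rewrite pickleK.
Qed.

(** A point outside the support has a space-time neighbourhood on which u vanishes almost everywhere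
    at each time, and the slice of that neighbourhood contains a rational box around the point.
    There are countably many boxes, so the exceptional null sets merge into one. *)
Lemma solution_supp_ae (R : realType) (n : nat) (m r : R) (T : \bar R)
    (u : R -> 'rV[R]_n -> R) (t : R) :
  solution_supp T u `<=` [set z | enorm z.2 <= r + phi m z.1] ->
  time_interval T t ->
  {ae lebesgue_rV R n, forall x, r + phi m t < enorm x -> u t x = 0}.
Proof.
move=> su tT.
pose good q := {ae lebesgue_rV R n, forall x, ratbox q x -> u t x = 0}.
have : {ae lebesgue_rV R n, forall x, forall q : 'rV[rat]_n * 'rV[rat]_n,
    good q -> ratbox q x -> u t x = 0}.
  apply: ae_countable => q.
  have [gq|ngq] := pselect (good q); first by apply: filterS gq => x xq _.
  exact: aeW.
apply: filterS => x xP xr.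
have /not_andP[//|/existsNP[U /not_implyP[oU /contrapT hU]]] :
    ~ solution_supp T u (t, x).
  by move=> /su /=; rewrite leNgt xr.
have nU : nbhs x (fun y => U (t, y)).
  have : (fun y : 'rV[R]_n => ((t, y) : spacetime R n)) @ nbhs x --> ((t, x) : spacetime R n).
    exact: (cvg_pair (cvg_cst (t : R^o)) cvg_id).
  by apply; exact: open_nbhs_nbhs oU.
have [q qx qU] := ratbox_base nU.
apply: (xP q) => //; apply: filterS (hU t tT) => y yU yq.
exact/yU/qU.
Qed.

Section L2_limits.
Context (R : realType) (n : nat).
Local Notation leb := (lebesgue_rV R n).

Lemma L2_cvg_integral (F : set_system R) (g : R -> 'rV[R]_n -> R) (Z : 'rV[R]_n -> R) :
  Filter F -> L2 Z -> (\forall s \near F, L2 (g s)) ->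
  L2norm (g s) @[s --> F] --> 0%E ->
  \int[leb]_x (g s x * Z x) @[s --> F] --> (0 : R).
Proof.
move=> FF Z2 g2 g0; apply/cvgrPdist_lt => e e0.
pose c := fine (L2norm Z); have cE : (c%:E = L2norm Z)%E by rewrite fineK// L2norm_fin.
have c0 : 0 <= c by rewrite fine_ge0// Lnorm_ge0.
have e1 : 0 < e / (c + 1) by rewrite divr_gt0// ltr_wpDl.
have gs : \forall s \near F, (L2norm (g s) < (e / (c + 1))%:E)%E.
  apply: (g0 [set y | (y < (e / (c + 1))%:E)%E]); rewrite /nbhs/= /ereal_nbhs/=.
  near=> x; rewrite /= lte_fin; near: x; exact: lt_nbhsl.
near=> s.
have gs2 : L2 (g s) by near: s.
rewrite sub0r normrN -lte_fin; apply: le_lt_trans (cauchy_schwarz gs2 Z2) _.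
rewrite -cE; apply: (@le_lt_trans _ _ ((e / (c + 1))%:E * c%:E)%E).
  by rewrite lee_wpmul2r// ?lee_fin//; apply/ltW; near: s.
by rewrite -EFinM lte_fin mulrAC ltr_pdivrMr ?ltr_wpDl// ltr_pM2l//; lra.
Unshelve. all: by end_near. Qed.

Lemma Rintegral_L2B (f g Z : 'rV[R]_n -> R) : L2 f -> L2 g -> L2 Z ->
  \int[leb]_x ((f x - g x) * Z x) =
  \int[leb]_x (f x * Z x) - \int[leb]_x (g x * Z x).
Proof.
move=> f2 g2 Z2; rewrite -RintegralB//; [|exact: L2_integrableM..].
by apply: eq_Rintegral => x _; rewrite mulrBl.
Qed.

Lemma Rintegral_sum d (T : measurableType d) (mu : {measure set T -> \bar R})
    (I : Type) (s : seq I) (f : I -> T -> R) :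
  (forall i, mu.-integrable setT (fun x => (f i x)%:E)) ->
  \int[mu]_x (\sum_(i <- s) f i x) = \sum_(i <- s) \int[mu]_x f i x.
Proof.
move=> intf; suff [] : mu.-integrable setT (fun x => (\sum_(i <- s) f i x)%:E) /\
    \int[mu]_x (\sum_(i <- s) f i x) = \sum_(i <- s) \int[mu]_x f i x by [].
elim: s => [|i s [IHi IHe]].
  split; last by rewrite big_nil; under eq_Rintegral do rewrite big_nil;
    rewrite Rintegral_cst// mul0r.
  under eq_fun do rewrite big_nil; exact: integrable0.
split.
  under eq_fun do rewrite big_cons EFinD; exact: integrableD.
rewrite big_cons -IHe -RintegralD//; last exact: intf.
by apply: eq_Rintegral => x _; rewrite big_cons.
Qed.

Lemma ae_eq_Rintegral d (T : measurableType d) (mu : {measure set T -> \bar R})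
    (f g : T -> R) : measurable_fun setT f -> measurable_fun setT g ->
  {ae mu, forall x, f x = g x} -> \int[mu]_x f x = \int[mu]_x g x.
Proof.
move=> mf mg fg; rewrite /Rintegral; congr fine.
apply: ae_eq_integral => //; [exact/measurable_EFinP..|].
by apply: filterS fg => x xfg _ /=; rewrite xfg.
Qed.

End L2_limits.

(** * Exponential averages of a solution *)

Section energy_identity.
Context (R : realType) (n : nat).
Local Notation leb := (lebesgue_rV R n).
Local Notation leb1 := (@lebesgue_measure R).
Variables (m p r : R) (T : \bar R) (u ut : R -> 'rV[R]_n -> R).
Variable gradu : R -> 'I_n -> 'rV[R]_n -> R.
Hypotheses (m_gt0 : 0 < m) (p_gt0 : 0 < p).
Hypothesis H1u : forall t, time_interval T t -> H1 (u t) (gradu t).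
Hypothesis cu : L2_continuous T u.
Hypothesis L2ut : forall t, time_interval T t -> L2 (ut t).
Hypothesis du : L2_derivative T u ut.
Hypothesis wu : weak_identity m p T u ut gradu.
Hypothesis su : solution_supp T u `<=` [set z | enorm z.2 <= r + phi m z.1].

Definition exp_average (w : 'rV[R]_n) (t : R) : R :=
  \int[leb]_x (u t x * expdot w x).

(** An extended real, since finiteness at a given time is not known. *)
Definition exp_power (w : 'rV[R]_n) (t : R) : \bar R :=
  (\int[leb]_x (`|u t x| `^ p * expdot w x)%:E)%E.

Variables (t1 d : R) (w : 'rV[R]_n).
Hypothesis t1_gt0 : 0 < t1.
Hypothesis d_gt0 : 0 < d.
Hypothesis t1dT : ((t1 + 2 * d)%:E < T)%E.

(** One more than the radius reached at [t1]: up to that time the support of u lies in the open box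
    where [Z] and its derivatives are those of the exponential. *)
Let L : R := r + phi m t1 + 1.
Let Z := expcut L w.
Let q : R := \sum_(i < n) w ord0 i ^+ 2.
Let F := exp_average w.
(** Paired with the truncated [Z] and not with the exponential: the support condition concerns u,
    while [ut t] is only given as square-integrable. *)
Let V (t : R) : R := \int[leb]_x (ut t x * Z x).
Let g (s : R) : R := s `^ m * (q * F s).
Let I (t : R) : R := \int[leb1]_(s in `[0, t]) g s.

Let tT t : 0 <= t -> t <= t1 -> time_interval T t.
Proof.
move=> t0 tt1; split => //; apply: le_lt_trans t1dT; rewrite lee_fin.
by have := d_gt0; lra.
Qed.

Let phi_le s : 0 <= s -> s <= t1 -> phi m s <= phi m t1.
Proof.
have m0 := m_gt0; move=> s0 st; rewrite /phi ler_wpM2l//.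
  by rewrite divr_ge0//; lra.
by apply: ge0_ler_powR; rewrite ?nnegrE//; lra.
Qed.

Let L2u t : 0 <= t -> t <= t1 -> L2 (u t).
Proof. by move=> t0 tt1; have [] := H1u (tT t0 tt1). Qed.

Let measurable_u t : 0 <= t -> t <= t1 -> measurable_fun setT (u t).
Proof. by move=> t0 tt1; have [/L2_measurable] := H1u (tT t0 tt1). Qed.

Let Z_test : test_function Z. Proof. exact: test_function_expcut. Qed.

Let L2_test (f : 'rV[R]_n -> R) : test_function f -> L2 f.
Proof.
move=> [Sf cf]; have [M [_ MP]] : bounded_set (supp f) by exact: compact_bounded.
apply: (@continuous_compact_L2 _ _ f (`|M| + 1)); first exact: Sf 0%N.
move=> x fx i; rewrite /= in_itv/= -ler_norml.
have xs : `|x| <= `|M| + 1.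
  apply: MP; first by have := ler_norm M; lra.
  exact: subset_closure.
apply: le_trans xs.
rewrite [leRHS]/Num.norm/= mx_normrE.
exact: (le_bigmax _ (fun ij : 'I_1 * 'I_n => `|x ij.1 ij.2|) (ord0, i)).
Qed.

Let Z2 : L2 Z. Proof. exact: L2_test. Qed.

Let measurable_exp : measurable_fun setT (expdot w).
Proof. by apply: continuous_measurable_rV; exact: smooth_expdot w 0%N. Qed.

(* On the support of [u t], up to a null set, all cut-offs equal 1. *)
Let ae_box s : 0 <= s -> s <= t1 ->
  {ae leb, forall x, u s x = 0 \/ forall i, `|x ord0 i| < L}.
Proof.
move=> s0 st; apply: filterS (solution_supp_ae su (tT s0 st)) => x xP.
have [xr|xr] := leP (enorm x) (r + phi m s); last by left; exact: xP.
right=> i; apply: le_lt_trans (coord_le_enorm x i) _.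
by have := phi_le s0 st; rewrite /L; lra.
Qed.

Let Z_eq (x : 'rV[R]_n) : (forall i, `|x ord0 i| < L) -> Z x = expdot w x.
Proof. by move=> xL; apply: expcut_eq => i; exact/ltW. Qed.

Let FE s : 0 <= s -> s <= t1 -> F s = \int[leb]_x (u s x * Z x).
Proof.
move=> s0 st; apply: ae_eq_Rintegral.
- by apply: measurable_funM; [exact: measurable_u|exact: measurable_exp].
- by apply: measurable_funM; [exact: measurable_u|exact: L2_measurable].
apply: filterS (ae_box s0 st) => x [->|/Z_eq ->//]; by rewrite !mul0r.
Qed.

Let cF : {within `[0, t1], continuous F}.
Proof.
apply/subspace_continuousP => t /=; rewrite in_itv/= => /andP[t0 tt1].
have tTt := tT t0 tt1.
have near_itv : \forall s \near within `[0, t1] (nbhs t), 0 <= s /\ s <= t1.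
  by rewrite near_withinE; near=> s => /=; rewrite in_itv/= => /andP.
have lim0 : \int[leb]_x ((u s x - u t x) * Z x) @[s --> within `[0, t1] (nbhs t)] --> (0 : R).
  apply: (@L2_cvg_integral R n _ (fun s x => u s x - u t x) Z) => //.
    apply: filterS near_itv => s [s0 st].
    by apply: L2B; exact: L2u.
  apply: cvg_trans (cu tTt); apply: cvg_app.
  move=> A nA.
  suff : \forall s \near t, `[0, t1]%classic s -> A s by [].
  have : \forall s \near t, time_interval T s -> A s := nA.
  apply: filterS => s sA; by rewrite /= in_itv/= => /andP[s0 st]; apply: sA; exact: tT.
apply/cvgrPdist_lt => e e0.
move/cvgrPdist_lt : lim0 => /(_ e e0) nA.
apply: filterS2 near_itv nA => s [s0 st].
have E : \int[leb]_x ((u s x - u t x) * Z x) = F s - F t.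
  by rewrite (Rintegral_L2B (L2u s0 st) (L2u t0 tt1) Z2) (FE s0 st) (FE t0 tt1).
by rewrite sub0r normrN E distrC.
Unshelve. all: by end_near. Qed.

(** The difference quotients of u converge in L^2; Cauchy-Schwarz against the fixed [Z] turns this
    into differentiability of the average. *)
Let dF t : t \in `]0, t1[ -> has_derivative F t (V t).
Proof.
rewrite in_itv/= => /andP[t0 tt1]; have tTt := tT (ltW t0) (ltW tt1).
have near_tT : \forall s \near t^', [/\ 0 <= s, s <= t1 & s != t].
  near=> s; split.
  - apply/ltW; near: s; apply: nbhs_dnbhs; exact: lt_nbhsr.
  - apply/ltW; near: s; apply: nbhs_dnbhs; exact: lt_nbhsl.
  - near: s; exact: nbhs_dnbhs_neq.
have lim0 : \int[leb]_x (((u s x - u t x) / (s - t) - ut t x) * Z x) @[s --> t^'] --> (0 : R).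
  apply: (@L2_cvg_integral R n _ (fun s x => (u s x - u t x) / (s - t) - ut t x) Z) => //.
    apply: filterS near_tT => s [s0 st _].
    apply: L2B; last exact: L2ut.
    by apply: L2Z; apply: L2B; apply: L2u => //; exact: ltW.
  apply: cvg_trans (du tTt); apply: cvg_app.
  move=> A nA.
  suff : \forall s \near t, s != t -> A s by [].
  have nA' : \forall s \near t, (time_interval T `\` [set t]) s -> A s := nA.
  have nB : \forall s \near t, s != t -> [/\ 0 <= s, s <= t1 & s != t] := near_tT.
  apply: filterS2 nA' nB => s sA sP st; apply: sA.
  by have [s0 st1 _] := sP st; split; [exact: tT|exact/eqP].
have lim1 : (F s - F t) / (s - t) @[s --> t^'] --> V t.
  apply/cvgrPdist_lt => e e0; move/cvgrPdist_lt : lim0 => /(_ e e0) nA.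
  apply: filterS2 near_tT nA => s [s0 st _].
  have L2s := L2u s0 st; have L2t := L2u (ltW t0) (ltW tt1).
  have ust : L2 (fun x => u s x - u t x) by exact: L2B.
  have E : \int[leb]_x ((u s x - u t x) / (s - t) * Z x) = (F s - F t) / (s - t).
    rewrite (FE s0 st) (FE (ltW t0) (ltW tt1)) -(Rintegral_L2B L2s L2t Z2).
    rewrite -RintegralZr//; last exact: (L2_integrableM ust Z2).
    by apply: eq_Rintegral => x _; rewrite mulrAC.
  by rewrite sub0r normrN (Rintegral_L2B (L2Z _ ust) (L2ut tTt) Z2) E distrC.
have lim2 : h^-1 *: ((F \o shift t) (h *: 1) - F t) @[h --> 0^'] --> V t.
  have sh : (fun h : R => h + t) @ 0^' --> t^'.
    move=> A nA; have nA' : \forall s \near t, s != t -> A s := nA.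
    suff : \forall h \near 0, h != 0 -> A (h + t) by [].
    move: nA'; rewrite (near_shift 0 t) subr0; apply: filterS => h hA h0.
    by apply: hA; rewrite /= -subr_eq0 addrK.
  have -> : (fun h : R => h^-1 *: ((F \o shift t) (h *: 1) - F t)) =
      (fun s => (F s - F t) / (s - t)) \o (fun h => h + t).
    by apply/funext => h /=; rewrite addrK [_ *: 1]mulr1 mulrC.
  exact: cvg_comp lim1.
by apply: DeriveDef; [apply/cvg_ex; exists (V t)|exact: cvg_lim lim2].
Unshelve. all: by end_near. Qed.

Let cg : {within `[0, t1], continuous g}.
Proof.
move=> x; apply: cvgM; first exact: powR_within_continuous.
apply: cvgM; [exact: cvg_cst|exact: cF].
Qed.

Let intg : leb1.-integrable `[0, t1] (EFin \o g).
Proof.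
by apply: continuous_compact_integrable; [exact: segment_compact|exact: cg].
Qed.

Let cI : {within `[0, t1], continuous I}.
Proof. exact: (parameterized_integral_continuous (ltW t1_gt0) intg). Qed.

Let dI t : t \in `]0, t1[ -> has_derivative I t (g t).
Proof.
move=> tt; have := tt; rewrite in_itv/= => /andP[t0 tt1].
have [cgt _ _] := (continuous_within_itvP _ t1_gt0).1 cg.
have [dIt DI] := continuous_FTC1_closed tt1 intg t0 (cgt t tt).
by apply: DeriveDef; [exact: dIt|rewrite -derive1E; exact: DI].
Qed.

(** The test function is constant in time on [0, t1]. The gradient term is integrated by parts,
    testing the weak gradient against the partial derivatives of [Z], and the Laplacian of [Z]
    equals |w|^2 exp(w.x) almost everywhere that u s is nonzero. *)
Let space_identity s : 0 <= s -> s <= t1 ->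
  \int[leb]_x (ut s x * dt (stcut t1 d L w) (s, x) -
    s `^ m * \sum_(i < n) gradu s i x * dx i (stcut t1 d L w) (s, x)) = g s.
Proof.
move=> s0 st; have [L2s gs] := H1u (tT s0 st).
pose DZ i := fun x : 'rV[R]_n => 'D_(delta_mx ord0 i) Z x.
have tDZ i : test_function (DZ i) by exact: test_function_derive.
have intgD i : leb.-integrable setT (fun x => (gradu s i x * DZ i x)%:E).
  by apply: L2_integrableM; [have [] := gs i|exact: L2_test].
transitivity (\int[leb]_x (- s `^ m * \sum_(i < n) gradu s i x * DZ i x)).
  apply: eq_Rintegral => x _.
  rewrite dt_stcut// mulr0 sub0r mulNr; congr (- (_ * _)).
  by apply: eq_bigr => i _; rewrite dx_stcut.
rewrite RintegralZl//; last first.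
  rewrite (_ : _ \o _ = fun x => (\sum_(i < n) (gradu s i x * DZ i x)%:E)%E); last first.
    by apply/funext => x /=; rewrite sumEFin.
  by apply: integrable_sum.
rewrite Rintegral_sum// /g mulNr -mulrN; congr (_ * _).
rewrite /q mulr_suml -sumrN; apply: eq_bigr => i _.
have [_ /(_ (DZ i) (tDZ i)) wp] := gs i.
rewrite -wp FE// -RintegralZl//; last exact: (L2_integrableM (L2u s0 st) Z2).
apply: ae_eq_Rintegral.
- apply: measurable_funM; first exact: measurable_u.
  apply: (L2_measurable (f := fun x => 'D_(delta_mx ord0 i) (DZ i) x)).
  by apply: L2_test; exact: test_function_derive.
- apply: measurable_funM; first exact: measurable_cst.
  by apply: measurable_funM; [exact: measurable_u|exact: L2_measurable].
apply: filterS (ae_box s0 st) => x [->|xL]; first by rewrite !(mul0r, mulr0).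
rewrite /DZ derive2_expcut// dotp_delta Z_eq//; ring.
Qed.

Let rhs_identity s : 0 <= s -> s <= t1 ->
  (\int[leb]_x (`|u s x| `^ p * stcut t1 d L w (s, x))%:E = exp_power w s)%E.
Proof.
move=> s0 st.
have mp : measurable_fun setT (fun x => `|u s x| `^ p).
  apply: (@measurableT_comp _ _ _ _ _ _ (fun y : R => y `^ p)) => //.
  by apply: measurableT_comp => //; exact: measurable_u.
apply: ge0_ae_eq_integral => //.
- apply/measurable_EFinP; apply: measurable_funM => //.
  rewrite (_ : (fun x => stcut t1 d L w (s, x)) = Z); first exact: L2_measurable.
  by apply/funext => x; rewrite stcut_eq//; have := d_gt0; lra.
- by apply/measurable_EFinP; apply: measurable_funM.
- by move=> x _; rewrite lee_fin mulr_ge0 ?powR_ge0 ?stcut_ge0.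
- by move=> x _; rewrite lee_fin mulr_ge0 ?powR_ge0 ?expR_ge0.
apply: filterS (ae_box s0 st) => x xP _ /=; congr (_%:E).
rewrite stcut_eq//; [|lra|by have := d_gt0; lra]; rewrite -/Z.
by case: xP => [->|/Z_eq ->//]; rewrite normr0 powR0 ?mul0r// gt_eqF.
Qed.

Let flux_identity t : 0 < t -> t <= t1 ->
  ((V t - V 0 - I t)%:E = \int[leb1]_(s in `[0%R, t]) exp_power w s)%E.
Proof.
move=> t0 tt1.
have tT1 : (t%:E < T)%E by have [] := tT (ltW t0) tt1.
have := wu (test_function_stcut d_gt0 L w t1dT) t0 tT1.
have -> : \int[leb]_x (ut t x * stcut t1 d L w (t, x)) = V t.
  by apply: eq_Rintegral => x _; rewrite stcut_eq//; have := d_gt0; lra.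
have -> : \int[leb]_x (ut 0 x * stcut t1 d L w (0, x)) = V 0.
  by apply: eq_Rintegral => x _; rewrite stcut_eq//; have := d_gt0; have := t1_gt0; lra.
under [X in _ - _ - X]eq_Rintegral => s.
  rewrite inE/= in_itv/= => /andP[s0 st].
  rewrite space_identity//; last exact: le_trans tt1.
  over.
move=> ->; apply: eq_integral => s; rewrite inE/= in_itv/= => /andP[s0 st].
by rewrite rhs_identity//; exact: le_trans tt1.
Qed.

Let exp_power_ge0 s : (0 <= exp_power w s)%E.
Proof. by apply: integral_ge0 => x _; rewrite lee_fin mulr_ge0 ?powR_ge0 ?expR_ge0. Qed.

(** Difference of [flux_identity] at t and at s. [exp_power] enters through a constant lower bound
    and [lower_integral_itv], so additivity of its integral over [0, s] and [s, t] is never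
    invoked. *)
Let flux_increment s t k : 0 <= s -> s <= t -> t <= t1 -> 0 <= k ->
  (forall x, s <= x <= t -> (k%:E <= exp_power w x)%E) ->
  I t - I s + k * (t - s) <= V t - V s.
Proof.
move=> s0 st tt1 k0 kH.
have [t0|t0] := leP t 0.
  have -> : t = s by lra.
  by rewrite !subrr mulr0 addr0.
have := @lower_integral_itv R (exp_power w) s t k exp_power_ge0 s0 st k0 kH.
rewrite -(flux_identity t0 tt1).
(* The weak identity holds at positive times only; for s = 0 the identity at t suffices, with I 0 =
   0. *)
move: s0; rewrite le_eqVlt => /predU1P[s0|s0]; last first.
  rewrite -(flux_identity s0 (le_trans st tt1)).
  by rewrite -EFinD lee_fin; lra.
rewrite -s0.
have -> : I 0 = 0 by rewrite /I set_itv1 Rintegral_set1.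
move=> h; suff : ((k * (t - 0))%:E <= (V t - V 0 - I t)%:E)%E by rewrite lee_fin; lra.
by apply: le_trans h; rewrite leeDr// integral_ge0.
Qed.

(** Applied for |w| = 1 with k = 0, where it expresses f'' >= t^m f, and for w = 0, where I'
    vanishes and it expresses F'' >= k. *)
Lemma energy_identity : exists v I : R -> R, [/\
  {within `[0, t1], continuous (exp_average w)},
  {within `[0, t1], continuous I},
  (forall x, x \in `]0, t1[ -> has_derivative (exp_average w) x (v x)),
  (forall x, x \in `]0, t1[ -> has_derivative I x
     (x `^ m * ((\sum_(i < n) w ord0 i ^+ 2) * exp_average w x))) &
  (forall s t k, 0 <= s -> s <= t -> t <= t1 -> 0 <= k ->
     (forall x, s <= x <= t -> (k%:E <= exp_power w x)%E) ->
     I t - I s + k * (t - s) <= v t - v s) /\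
  v 0 = \int[leb]_x (ut 0 x * expcut (r + phi m t1 + 1) w x) /\
  exp_average w 0 = \int[leb]_x (u 0 x * expcut (r + phi m t1 + 1) w x)].
Proof.
exists V, I; split; [exact: cF|exact: cI|exact: dF|exact: dI|split].
  exact: flux_increment.
split=> //.
by rewrite -/F FE// ltW.
Qed.

End energy_identity.

(** * Blow-up *)

(** Integrated form of F'' >= k F^p. From a value at least B, a step h doubles F once k h^2 B^(p-1)
    / 2 >= 1. Each doubling multiplies B^(p-1) by 2^(p-1), so the next step may shrink by r =
    2^(-(p-1)/2); starting from t (1 - r), the steps have total length t. *)
Lemma doubling_blowup (R : realType) (p k A t : R) (F : R -> R) :
  1 < p -> 0 <= k -> 0 < A -> 0 < t -> A <= F t ->
  (forall x y, t <= x -> x <= y -> y <= 2 * t ->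
     F x + k * F x `^ p * (y - x) ^+ 2 / 2 <= F y) ->
  1 <= k / 2 * (1 - 2 `^ (- ((p - 1) / 2))) ^+ 2 * t ^+ 2 * A `^ (p - 1) ->
  False.
Proof.
move=> p1 k0 A0 t0 At inc; set r := 2 `^ _ => big.
have r0 : 0 < r by rewrite powR_gt0.
have r1 : r < 1.
  rewrite /r powRN invf_lt1 ?powR_gt0//.
  have h : 0 < (p - 1) / 2 by lra.
  have := @gt0_ltr_powR R _ h 1 2; rewrite powR1 !nnegrE; apply; lra.
have r2 : r ^+ 2 * 2 `^ (p - 1) = 1.
  rewrite /r -powR_mulrn ?powR_ge0// -powRrM -gt0_powRD//.
  by rewrite (_ : _ + _ = 0) ?powRr0//; field.
(* The step of length [t (1 - r) r^j] doubles [F] when [F >= 2^j A]. *)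
have step (j : nat) : exists x, [/\ t <= x, x <= 2 * t - t * r ^+ j & 2 ^+ j * A <= F x].
  elim: j => [|j [x [tx xj Fx]]].
    by exists t; rewrite !expr0 mulr1 mul1r; split=> //; lra.
  have rj : 0 < r ^+ j by rewrite exprn_gt0.
  pose h := t * (1 - r) * r ^+ j.
  have h0 : 0 <= h by rewrite /h !mulr_ge0// ?ltW//; lra.
  have xh : x + h <= 2 * t - t * r ^+ j.+1.
    by rewrite /h exprSr; lra.
  have B0 : 0 < 2 ^+ j * A by rewrite mulr_gt0// exprn_gt0.
  have Fx0 : 0 < F x by exact: lt_le_trans Fx.
  exists (x + h); split=> //; first by lra.
  have trj : 0 <= t * r ^+ j.+1 by rewrite mulr_ge0 ?exprn_ge0// ltW.
  have := inc x (x + h) tx ltac:(lra) ltac:(lra); rewrite addrAC subrr add0r.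
  apply: le_trans.
  have FpE : F x `^ p = F x * F x `^ (p - 1).
    by rewrite mulr_powRB1// ?ltW//; lra.
  have Fp : 2 `^ (p - 1) ^+ j * A `^ (p - 1) <= F x `^ (p - 1).
    have -> : 2 `^ (p - 1) ^+ j * A `^ (p - 1) = (2 ^+ j * A) `^ (p - 1).
      rewrite powRM ?exprn_ge0 ?(ltW A0)//; congr (_ * _).
      rewrite -(powR_mulrn j (powR_ge0 2 (p - 1))) -(powR_mulrn j (ler0n R 2)).
      by rewrite -!powRrM mulrC.
    have p10 : 0 <= p - 1 by lra.
    by apply: (ge0_ler_powR p10); rewrite ?nnegrE ?(ltW B0) ?(ltW Fx0).
  have rj2 : (r ^+ j) ^+ 2 * 2 `^ (p - 1) ^+ j = 1.
    by rewrite exprAC -exprMn r2 expr1n.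
  have : F x * 1 <= F x * (k / 2 * h ^+ 2 * F x `^ (p - 1)).
    rewrite ler_wpM2l ?(ltW Fx0)//; apply: le_trans big _.
    have -> : k / 2 * (1 - r) ^+ 2 * t ^+ 2 * A `^ (p - 1) =
        k / 2 * h ^+ 2 * (2 `^ (p - 1) ^+ j * A `^ (p - 1)).
      have -> : h ^+ 2 = (t * (1 - r)) ^+ 2 * (r ^+ j) ^+ 2 by rewrite /h exprMn.
      move: (2 `^ (p - 1) ^+ j) (r ^+ j) rj2 => b a ab.
      rewrite -[LHS]mulr1 -ab; ring.
    by rewrite ler_wpM2l// mulr_ge0 ?sqr_ge0//; lra.
  rewrite FpE [2 ^+ j.+1]exprS -[2 * _ * A]mulrA mulr1.
  have -> : F x * (k / 2 * h ^+ 2 * F x `^ (p - 1)) = k * (F x * F x `^ (p - 1)) * h ^+ 2 / 2.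
    by field.
  lra.
(* All the doublings take place before 2 t, so F (2 t) would exceed 2^j A for every j. *)
have [j jF] : exists j, F (2 * t) < 2 ^+ j * A.
  exists (Num.truncn (F (2 * t) / A)).+1; rewrite -ltr_pdivrMr//.
  apply: lt_le_trans (truncnS_gt _) _.
  by rewrite -natrX ler_nat ltnW// ltn_expl.
have [x [tx xj Fx]] := step j.
have trj : 0 <= t * r ^+ j by rewrite mulr_ge0 ?exprn_ge0// ltW.
have := inc x (2 * t) tx ltac:(lra) (lexx _).
have : 0 <= k * F x `^ p * (2 * t - x) ^+ 2 / 2.
  by rewrite divr_ge0// mulr_ge0 ?sqr_ge0// mulr_ge0// powR_ge0.
lra.
Qed.

(** * Lower bounds from the data and from Hoelder's inequality *)

Section lower_bounds.
Context (R : realType) (n : nat).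
Local Notation leb := (lebesgue_rV R n).

(** [k] is half a positive value of g0 times the volume of a box where g0 exceeds that half, and 0
    if g0 vanishes identically; thus u0 and u1 are treated separately although only one of them has
    to be nonzero. *)
Lemma initial_lower (r : R) (g0 : 'rV[R]_n -> R) :
  test_function g0 -> (forall x, 0 <= g0 x) ->
  supp g0 `<=` [set x | enorm x <= r] ->
  exists k : R, [/\ 0 <= k, (exists x, g0 x != 0) -> 0 < k &
    forall (eps e0 : R) (g Z : 'rV[R]_n -> R), 0 <= eps -> 0 <= e0 ->
      L2 g -> L2 Z -> {ae leb, forall x, g x = eps * g0 x} ->
      (forall x, 0 <= Z x) -> (forall x, enorm x <= r -> e0 <= Z x) ->
      eps * (e0 * k) <= \int[leb]_x (g x * Z x)].
Proof.
move=> [Sg _] g00 sg.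
(* g is nonnegative only almost everywhere; with |g| the integrand is nonnegative at every point. *)
have abs (eps : R) (g Z : 'rV[R]_n -> R) : 0 <= eps -> L2 g -> L2 Z ->
    {ae leb, forall x, g x = eps * g0 x} ->
    \int[leb]_x (g x * Z x) = \int[leb]_x (`|g x| * Z x).
  move=> eps0 /L2_measurable mg /L2_measurable mZ gE; apply: ae_eq_Rintegral.
  - exact: measurable_funM.
  - by apply: measurable_funM => //; exact: measurableT_comp mg.
  by apply: filterS gE => x ->; rewrite ger0_norm// mulr_ge0.
have [[x0 gx0]|g0E] := pselect (exists x, g0 x != 0); last first.
  exists 0; split=> // eps e0 g Z eps0 e00 g2 Z2 gE Z0 _.
  by rewrite !mulr0 (abs eps)//; apply: Rintegral_ge0 => x _; rewrite mulr_ge0.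
pose de := g0 x0 / 2.
have gx0' : 0 < g0 x0 by rewrite lt_neqAle eq_sym gx0 g00.
have de0 : 0 < de by rewrite divr_gt0.
have [q qx0 qU] : exists2 q, ratbox q x0 & ratbox q `<=` [set x : 'rV[R]_n | de < g0 x].
  apply: ratbox_base; have cg := Sg 0%N x0.
  by apply: (cg [set y | de < y]); apply: lt_nbhsr; rewrite /de; lra.
pose len (i : 'I_n) : R := ratr (q.2 ord0 i) - ratr (q.1 ord0 i).
have len0 i : 0 < len i.
  by have := qx0 i; rewrite /= in_itv/= => /andP[? ?]; rewrite /len; lra.
have muq : leb (ratbox q) = (\prod_(i < n) len i)%:E.
  rewrite (@lebesgue_rV_box R n (fun i => `]ratr (q.1 ord0 i), ratr (q.2 ord0 i)[%classic)).
    rewrite -prodEFin; apply: eq_bigr => i _; rewrite lebesgue_measure_itv/= lte_fin.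
    by have := len0 i; rewrite subr_gt0 => ->; rewrite -EFinB.
  by move=> i; exact: measurable_itv.
exists (de * \prod_(i < n) len i); split.
- by rewrite mulr_ge0 ?(ltW de0)// prodr_ge0// => i _; exact/ltW.
- by move=> _; rewrite mulr_gt0// prodr_gt0.
move=> eps e0 g Z eps0 e00 g2 Z2 gE Z0 Ze.
have mg := L2_measurable g2; have mZ := L2_measurable Z2.
have c0 : 0 <= eps * (e0 * de) by rewrite !mulr_ge0// ltW.
have mI : measurable_fun setT (fun x : 'rV[R]_n => (\1_(ratbox q) x : R)%:E).
  by have mq := @measurable_ratbox R n q; exact/measurable_EFinP.
have I0 (x : 'rV[R]_n) : setT x -> (0 <= (\1_(ratbox q) x : R)%:E)%E by rewrite lee_fin.
rewrite (abs eps)// -lee_fin /Rintegral fineK; last first.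
  apply: integrable_fin_num => //.
  rewrite (_ : (fun x => _) = abse \o (fun x => (g x * Z x)%:E)).
    by apply: integrable_abse; exact: L2_integrableM.
  by apply/funext => x /=; rewrite normrM (ger0_norm (Z0 x)).
have mq := @measurable_ratbox R n q.
have -> : eps * (e0 * (de * \prod_(i < n) len i)) =
    eps * (e0 * de) * \prod_(i < n) len i by ring.
rewrite EFinM -muq.
have -> : ((eps * (e0 * de))%:E * leb (ratbox q) =
    \int[leb]_x ((eps * (e0 * de))%:E * (\1_(ratbox q) x)%:E))%E.
  by rewrite (ge0_integralZl_EFin leb measurableT I0 mI c0) integral_indic// setIT.
apply: ae_ge0_le_integral => //.
- by move=> x _; rewrite mule_ge0// lee_fin.
- exact: measurable_funeM.
- by move=> x _; rewrite lee_fin mulr_ge0.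
- by apply/measurable_EFinP; apply: measurable_funM => //; exact: measurableT_comp mg.
apply: filterS gE => x gx _; rewrite -EFinM lee_fin gx indicE.
case: (boolP (x \in ratbox q)) => [/set_mem/qU/= dx|_]; last first.
  by rewrite mulr0 mulr_ge0.
rewrite mulr1 ger0_norm ?mulr_ge0// -mulrA ler_wpM2l// mulrC ler_pM ?(ltW de0) ?(ltW dx)//.
apply: Ze; apply: sg; apply: subset_closure => /=.
by rewrite gt_eqF//; lra.
Qed.

(** Hoelder's bound G^p / A^(p-1) up to the factor 2^(-p). It comes from integrating k^(p-1) a <=
    a^p + k^p, for a = |u|, against W on the ball: with k = G / (2 A) the loss k^p A is half of the
    gain k^(p-1) G. *)
Lemma power_lower (p ro G A : R) (u W : 'rV[R]_n -> R) : 1 < p ->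
  measurable_fun setT u -> measurable_fun setT W -> (forall x, 0 <= W x) ->
  {ae leb, forall x, ro < enorm x -> u x = 0} ->
  (\int[leb]_(x in [set x | (enorm x <= ro)%R]) (W x)%:E <= A%:E)%E ->
  0 < A -> 0 < G -> G <= \int[leb]_x (u x * W x) ->
  ((G / 2 * (G / (2 * A)) `^ (p - 1))%:E <= \int[leb]_x (`|u x| `^ p * W x)%:E)%E.
Proof.
move=> p1 mu mW W0 uE WA A0 G0 Gu.
have p_gt0 : 0 < p by lra.
pose k := G / (2 * A); have k0 : 0 < k by rewrite divr_gt0// mulr_gt0.
pose B : set 'rV[R]_n := [set x | enorm x <= ro].
have mB : measurable B by exact: measurable_enorm_le.
have young (a : R) : 0 <= a -> k `^ (p - 1) * a <= a `^ p + k `^ p.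
  move=> a0; have p10 : 0 <= p - 1 by lra.
  rewrite -(mulr_powRB1 a0 p_gt0) -(mulr_powRB1 (ltW k0) p_gt0).
  have [ak|ka] := leP a k.
    apply: ler_wpDl; first by rewrite mulr_ge0 ?powR_ge0.
    by rewrite mulrC ler_wpM2r ?powR_ge0.
  apply: ler_wpDr; first by rewrite mulr_ge0 ?powR_ge0// ltW.
  rewrite mulrC ler_wpM2l//.
  by apply: ge0_ler_powR; rewrite ?nnegrE// ltW.
have mup : measurable_fun setT (fun x => `|u x| `^ p).
  apply: (@measurableT_comp _ _ _ _ _ _ (fun y : R => y `^ p)) => //.
  exact: measurableT_comp mu.
have mau : measurable_fun setT (fun x => `|u x|) by exact: measurableT_comp mu.
have mWB : measurable_fun setT (fun x => (W x)%:E * (\1_B x : R)%:E)%E.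
  apply: emeasurable_funM; first exact/measurable_EFinP.
  exact/measurable_EFinP/measurable_indic.
have main : (\int[leb]_x ((k `^ (p - 1))%:E * (`|u x| * W x)%:E) <=
    \int[leb]_x ((`|u x| `^ p * W x)%:E + (k `^ p)%:E * ((W x)%:E * (\1_B x)%:E)))%E.
  apply: ae_ge0_le_integral => //.
  - by move=> x _; rewrite -EFinM lee_fin !mulr_ge0// powR_ge0.
  - by apply: measurable_funeM; apply/measurable_EFinP; exact: measurable_funM.
  - move=> x _; rewrite -!EFinM -EFinD lee_fin addr_ge0// !mulr_ge0 ?powR_ge0//.
  - apply: emeasurable_funD; last exact: measurable_funeM.
    by apply/measurable_EFinP; exact: measurable_funM.
  apply: filterS uE => x xE _; rewrite -!EFinM -EFinD lee_fin.
  have := young `|u x| (normr_ge0 _) => /(ler_wpM2r (W0 x)).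
  rewrite mulrDl mulrA => h; rewrite indicE.
  have [xB|xB] := pselect (B x); first by rewrite mem_set// mulr1 mulrA.
  rewrite memNset//.
  have -> : u x = 0.
    by apply: xE; rewrite ltNge; apply/negP.
  by rewrite normr0 powR0 ?mul0r ?mulr0 ?addr0//; rewrite gt_eqF//; lra.
have Gabs : (G%:E <= \int[leb]_x (`|u x| * W x)%:E)%E.
  have muW : measurable_fun setT (fun x => (u x * W x)%:E).
    by apply/measurable_EFinP; exact: measurable_funM.
  have le1 := le_abse_integral leb measurableT muW.
  have -> : (\int[leb]_x (`|u x| * W x)%:E = \int[leb]_x `|(u x * W x)%:E|)%E.
    by apply: eq_integral => x _; rewrite /= normrM (ger0_norm (W0 x)).
  apply: le_trans le1; apply: (@le_trans _ _ (\int[leb]_x (u x * W x))%:E).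
    by rewrite lee_fin.
  rewrite /Rintegral; case: (\int[leb]_x (u x * W x)%:E)%E => [z||] /=.
  - by rewrite lee_fin ler_norm.
  - exact: leey.
  - exact: leey.
move: main.
rewrite ge0_integralZl_EFin ?powR_ge0//; last 2 first.
- by move=> x _; rewrite lee_fin mulr_ge0.
- by apply/measurable_EFinP; exact: measurable_funM.
rewrite ge0_integralD//; last 4 first.
- by move=> x _; rewrite lee_fin mulr_ge0// powR_ge0.
- by apply/measurable_EFinP; exact: measurable_funM.
- by move=> x _; rewrite -!EFinM lee_fin !mulr_ge0 ?powR_ge0.
- exact: measurable_funeM.
rewrite ge0_integralZl_EFin ?powR_ge0//; last by move=> x _; rewrite -EFinM lee_fin mulr_ge0.
have -> : (\int[leb]_x ((W x)%:E * (\1_B x)%:E) = \int[leb]_(x in B) (W x)%:E)%E.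
  by rewrite [RHS]integral_mkcond epatch_indic; apply: eq_integral.
move=> main.
have {}main : ((k `^ (p - 1) * G)%:E <=
    \int[leb]_x (`|u x| `^ p * W x)%:E + (k `^ p * A)%:E)%E.
  apply: (@le_trans _ _ ((k `^ (p - 1))%:E * \int[leb]_x (`|u x| * W x)%:E)%E).
    by rewrite EFinM lee_wpmul2l// lee_fin powR_ge0.
  apply: le_trans main _; rewrite leeD2l// EFinM lee_wpmul2l//.
  by rewrite lee_fin powR_ge0.
have -> : G / 2 * k `^ (p - 1) = k `^ (p - 1) * G - k `^ p * A.
  rewrite -(mulr_powRB1 (ltW k0) p_gt0).
  by rewrite /k; set z := _ `^ _; field; rewrite gt_eqF.
by rewrite EFinB leeBlDr.
Qed.

End lower_bounds.

(* [H] enters only through lower bounds, since its measurability in time is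
   unknown. *)
Lemma integrate_twice (R : realType) (t1 : R) (F v I : R -> R) (H : R -> \bar R) :
  {within `[0, t1], continuous F} -> {within `[0, t1], continuous I} ->
  (forall x, x \in `]0, t1[ -> has_derivative F x (v x)) ->
  (forall x, x \in `]0, t1[ -> has_derivative I x 0) ->
  (forall s t k, 0 <= s -> s <= t -> t <= t1 -> 0 <= k ->
     (forall x, s <= x <= t -> (k%:E <= H x)%E) ->
     I t - I s + k * (t - s) <= v t - v s) ->
  (forall s, (0 <= H s)%E) -> 0 <= v 0 ->
  forall x y k, 0 <= x -> x <= y -> y <= t1 -> 0 <= k ->
    (forall s, x <= s <= y -> (k%:E <= H s)%E) ->
    F x + k * (y - x) ^+ 2 / 2 <= F y.
Proof.
move=> cF cI dF dI inc H0 v0 x y k x0 xy yt k0 kH.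
have sub (f : R -> R) a b : 0 <= a -> b <= t1 ->
    {within `[0, t1], continuous f} -> {within `[a, b], continuous f}.
  move=> a0 b0; apply: continuous_subspaceW => z /=.
  by rewrite !in_itv/= => /andP[za zb]; rewrite (le_trans a0)// (le_trans zb).
have Imono a b : 0 <= a -> a <= b -> b <= t1 -> I a <= I b.
  move=> a0 ab bt; apply: (@le_derive_ge0 R I (fun=> 0)) => //; first exact: sub.
  move=> z; rewrite in_itv/= => /andP[az zb]; apply: dI.
  by rewrite in_itv/= (le_lt_trans a0)// (lt_le_trans zb).
have vx : 0 <= v x.
  have := inc 0 x 0 (lexx _) x0 (le_trans xy yt) (lexx _) (fun s _ => H0 s).
  by have := Imono 0 x (lexx _) x0 (le_trans xy yt); lra.
pose h (z : R) := k / 2 * (z - x) ^+ 2.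
have dh (z : R) : is_derive z 1 h (k * (z - x)).
  by apply: is_derive_eq; rewrite /GRing.scale/=; field.
have : (F - h) x <= (F - h) y.
  apply: (@le_derive_ge0 R _ (fun z => v z - k * (z - x))) => //.
  - apply: within_continuousB; first exact: sub.
    apply: continuous_subspaceT => z; apply: differentiable_continuous.
    by apply/derivable1_diffP; have [] := dh z.
  - move=> z; rewrite in_itv/= => /andP[xz zy].
    have ? : has_derivative F z (v z) by apply: dF; rewrite in_itv/=; lra.
    exact: is_deriveB.
  - move=> z; rewrite in_itv/= => /andP[xz zy].
    have := inc x z k x0 (ltW xz) ltac:(lra) k0.
    have := Imono x z x0 (ltW xz) ltac:(lra).
    move=> Ixz /(_ _)/(le_trans _) h1.
    have : I z - I x + k * (z - x) <= v z - v x.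
      apply: inc => //; [exact: ltW|lra|].
      by move=> s /andP[xs sz]; apply: kH; rewrite xs/=; lra.
    lra.
have e z : (F - h) z = F z - h z by [].
rewrite !e /h subrr expr0n/= mulr0; lra.
Qed.

(** The quadratic is not solved: q gamma(p) = p gamma(q) + (q - p) (al p q + m + 2) transfers the
    sign from the root q to p < q. *)
Lemma gamma_gt0 (R : realType) (m p : R) (n : nat) : 0 < m -> (1 <= n)%N ->
  0 < p -> p < p_crit m n -> 0 < gamma m n p.
Proof.
(* Without a root [p_crit] would be the default 0, contradicting 0 < p < p_crit. *)
move=> m0 n1 p0; rewrite /p_crit; case: xgetP => [q _ [q0 gq] pq|_]; last by lra.
have n1' : 1 <= n%:R :> R by rewrite ler1n.
move: gq; rewrite /gamma; set al := (m + 2) * (n%:R / 2) - 1; set be := _ - 3 => gq.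
have al0 : 0 < al by rewrite /al; nra.
rewrite -(pmulr_rgt0 _ q0).
have -> : q * (- al * p ^+ 2 - be * p + (m + 2)) =
    p * (- al * q ^+ 2 - be * q + (m + 2)) + (q - p) * (al * p * q + (m + 2)) by ring.
by rewrite gq mulr0 add0r mulr_gt0 ?subr_gt0// addr_gt0 ?mulr_gt0//; lra.
Qed.

Lemma powR_expR (R : realType) (x a : R) : 0 < x -> x `^ a = expR (a * ln x).
Proof. by move=> x0; rewrite /powR gt_eqF. Qed.

(** [power_lower] for each wave of [directions], summed: on the ball the waves add up to at most (4
    pi)^n exp ro, and outside it u vanishes. [expdot 0] is the constant 1. *)
Lemma directional_power (R : realType) (n : nat) (p ro G : R) (u : 'rV[R]_n.+1 -> R) :
  1 < p -> 0 < ro -> 0 < G -> measurable_fun setT u ->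
  {ae lebesgue_rV R n.+1, forall x, ro < enorm x -> u x = 0} ->
  (forall w : 'rV[R]_n.+1, \sum_(i < n.+1) w ord0 i ^+ 2 = 1 ->
     G <= \int[lebesgue_rV R n.+1]_x (u x * expdot w x)) ->
  ((((Num.sqrt ro / (2 * n.+1%:R)) ^+ n) *
    (G / 2 * (G / (2 * (4 * Num.sqrt (4 * pi * ro) ^+ n * expR ro))) `^ (p - 1)))%:E
   <= ((4 * pi) ^+ n * expR ro)%:E *
      \int[lebesgue_rV R n.+1]_x (`|u x| `^ p * expdot 0 x)%:E)%E.
Proof.
move=> p1 ro0 G0 mu uE Gw.
have [J [w [w1 wh wS wN]]] := directions n ro0.
set A := 4 * _ ^+ n * _; set lo := G / 2 * _.
have A0 : 0 < A.
  by rewrite /A !mulr_gt0 ?expR_gt0// exprn_gt0// sqrtr_gt0 !mulr_gt0// pi_gt0.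
have lo0 : 0 <= lo by rewrite /lo mulr_ge0 ?powR_ge0// divr_ge0// ltW.
have mexp (v : 'rV[R]_n.+1) : measurable_fun setT (expdot v).
  by apply: continuous_measurable_rV; exact: smooth_expdot v 0%N.
have mup : measurable_fun setT (fun x => `|u x| `^ p).
  apply: (@measurableT_comp _ _ _ _ _ _ (fun y : R => y `^ p)) => //.
  exact: measurableT_comp mu.
have each j : (lo%:E <=
    \int[lebesgue_rV R n.+1]_x (`|u x| `^ p * expdot (w j) x)%:E)%E.
  apply: (@power_lower R n.+1 p ro G A) => //.
  - by move=> x; exact: expR_ge0.
  - exact: plane_wave_integral.
  - exact: Gw.
apply: (@le_trans _ _ (\sum_(j : J) lo%:E)%E).
  by rewrite sumEFin lee_fin sumr_const -[leRHS]mulr_natl ler_wpM2r.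
apply: (@le_trans _ _ (\sum_(j : J)
    \int[lebesgue_rV R n.+1]_x (`|u x| `^ p * expdot (w j) x)%:E)%E).
  by apply: lee_sum => j _.
rewrite -ge0_integral_sum//; last 2 first.
- by move=> j; apply/measurable_EFinP; exact: measurable_funM.
- by move=> j x _; rewrite lee_fin mulr_ge0 ?powR_ge0 ?expR_ge0.
have C0 : 0 <= (4 * pi) ^+ n * expR ro :> R.
  by rewrite mulr_ge0 ?expR_ge0// exprn_ge0// mulr_ge0// pi_ge0.
have f0 (x : 'rV[R]_n.+1) : setT x -> (0 <= (`|u x| `^ p * expdot 0 x)%:E)%E.
  by rewrite lee_fin mulr_ge0 ?powR_ge0 ?expR_ge0.
have mf : measurable_fun setT (fun x => (`|u x| `^ p * expdot 0 x)%:E).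
  by apply/measurable_EFinP; exact: measurable_funM.
rewrite -(ge0_integralZl_EFin _ measurableT f0 mf C0).
apply: ae_ge0_le_integral => //.
- by move=> x _; apply: sume_ge0 => j _; rewrite lee_fin mulr_ge0 ?powR_ge0 ?expR_ge0.
- by apply: emeasurable_sum => j; apply/measurable_EFinP; exact: measurable_funM.
- by move=> x _; rewrite mule_ge0 ?f0// lee_fin.
- exact: measurable_funeM.
apply: filterS uE => x xE _; rewrite sumEFin -EFinM lee_fin -mulr_sumr.
have -> : expdot 0 x = 1 :> R.
  by rewrite /expdot /dotp big1 ?expR0// => i _; rewrite mxE mul0r.
rewrite mulr1 mulrC; have [xr|xr] := leP (enorm x) ro.
  by rewrite ler_wpM2r ?powR_ge0// wS.
by rewrite xE// normr0 powR0 ?mulr0// gt_eqF//; lra.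
Qed.

(** [dist_sphere] for the direction - w, where the sum of squares is nonnegative. *)
Lemma dotp_ge (R : realType) (n : nat) (w x : 'rV[R]_n) (r : R) : 0 < r ->
  \sum_(i < n) w ord0 i ^+ 2 = 1 -> enorm x <= r -> - r <= dotp w x.
Proof.
move=> r0 w1 xr.
have w1' : \sum_(i < n) (- w) ord0 i ^+ 2 = 1.
  by rewrite -w1; apply: eq_bigr => i _; rewrite mxE sqrrN.
have := dist_sphere (ltW r0) w1' xr; set S := \sum_(i < n) _ => h.
have S0 : 0 <= S by apply: sumr_ge0 => i _; exact: sqr_ge0.
have : 0 <= 2 * r * (r - dotp (- w) x) by exact: le_trans h.
rewrite pmulr_rge0 ?mulr_gt0//.
have -> : dotp (- w) x = - dotp w x.
  by rewrite /dotp -sumrN; apply: eq_bigr => i _; rewrite mxE mulNr.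
lra.
Qed.

(** Every factor is written as an exponential, which leaves an inequality between exponents with
    [l0] collecting the constants. Replacing exp(p phi) by exp(p ro) costs the summand p r. *)
Lemma power_asymptotics (R : realType) (n : nat) (m r c p : R) :
  0 < m -> 0 < r -> 0 < c ->
  exists2 C : R, 0 < C & forall s eps ro G : R, 1 <= s -> 0 < eps ->
    ro = r + phi m s -> G = c * eps * (s `^ (- (m / 4)) * expR (phi m s)) ->
    C * (eps `^ p * s `^ (n%:R * (2 - p) / 2 * ((m + 2) / 2) - m * p / 4)) *
      ((4 * pi) ^+ n * expR ro) <=
    (Num.sqrt ro / (2 * n.+1%:R)) ^+ n *
    (G / 2 * (G / (2 * (4 * Num.sqrt (4 * pi * ro) ^+ n * expR ro))) `^ (p - 1)).
Proof.
move=> m0 r0 c0; set mu := (m + 2) / 2.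
have mu0 : 0 < mu by rewrite /mu; lra.
have k0 : 0 < 2 / (m + 2) :> R by rewrite divr_gt0//; lra.
have ex (x : R) : 0 < x -> exists l, x = expR l by move=> x0; exists (ln x); rewrite lnK.
have [l1 E1] : exists l, 2 * n.+1%:R = expR l :> R by apply: ex; rewrite mulr_gt0.
have [l2 E2] : exists l, 2 = expR l :> R by exact: ex.
have [l4 E4] : exists l, 4 = expR l :> R by exact: ex.
have [lp Ep] : exists l, 4 * pi = expR l :> R by apply: ex; rewrite mulr_gt0 ?pi_gt0.
have [lk Ek] := ex _ k0.
have [lK EK] : exists l, r + 2 / (m + 2) = expR l by apply: ex; rewrite addr_gt0.
have [lc Ec] := ex _ c0.
pose e := n%:R * (2 - p) / 2 : R.
(* [K] bounds the distance from ln ro to mu ln s, since phi m s <= ro <= (r + 2 / (m + 2)) s^mu.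
   Absolute values are taken because the sign of e is that of 2 - p, which may be either. *)
pose K : R := `|lk| + `|lK|.
pose l0 := p * lc - n%:R * l1 - l2 - (p - 1) * (l2 + l4 + n%:R * lp / 2)
  - n%:R * lp - p * r - `|e| * K.
exists (expR l0); first exact: expR_gt0.
move=> s eps ro G s1 eps0 roE G0.
have s0 : 0 < s by lra.
have [ls Es] := ex _ s0; have [le Ee] := ex _ eps0.
have sE a : s `^ a = expR (a * ls) by rewrite powR_expR// Es expRK.
have ro0 : 0 < ro by rewrite roE /phi ltr_pwDl// mulr_ge0 ?powR_ge0// ltW.
have [lr Er] := ex _ ro0.
have phE : phi m s = expR (lk + mu * ls) by rewrite /phi -/mu sE Ek -expRD.
have lr1 : lk + mu * ls <= lr.
  by rewrite -ler_expR -Er -phE roE; lra.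
have lr2 : lr <= lK + mu * ls.
  have ls0 : 0 <= ls by rewrite -ler_expR expR0 -Es.
  rewrite -ler_expR -Er roE phE !expRD -Ek -EK [leRHS]mulrDl lerD2r.
  by rewrite ler_peMr ?(ltW r0)// -expR0 ler_expR mulr_ge0// ltW.
have lrK : `|lr - mu * ls| <= K.
  rewrite ler_norml /K; have := ler_norm lK; have := ler_norm (- lk); rewrite normrN.
  have := normr_ge0 lk; have := normr_ge0 lK => *; apply/andP; split; lra.
have eK : - (`|e| * K) <= e * (lr - mu * ls).
  rewrite lerNl -mulrN; apply: le_trans (ler_norm _) _; rewrite normrM normrN.
  by rewrite ler_wpM2l.
have sqE a : Num.sqrt (expR a) = expR (a / 2) :> R.
  by rewrite -powR12_sqrt ?expR_ge0// -expRM.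
have GE : G = expR (lc + le - m / 4 * ls + phi m s).
  by rewrite G0 Ec Ee sE -!expRD; congr expR; ring.
set g := lc + _ - _ + _ in GE.
have -> : (Num.sqrt ro / (2 * n.+1%:R)) ^+ n = expR (n%:R * (lr / 2 - l1)).
  by rewrite E1 Er sqE -expRN -expRD -expRM_natl.
have -> : 2 * (4 * Num.sqrt (4 * pi * ro) ^+ n * expR ro) =
    expR (l2 + (l4 + n%:R * ((lp + lr) / 2) + ro)).
  by rewrite Ep [in Num.sqrt _]Er -expRD sqE -expRM_natl !expRD -E2 -E4.
have -> : G / 2 = expR (g - l2) by rewrite GE expRB -E2.
rewrite GE -expRN -[expR g * _]expRD -expRM Ee -expRM sE Ep -expRM_natl -!expRD ler_expR.
rewrite /l0 /g.
have -> : phi m s = ro - r by rewrite roE; ring.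
have := eK; rewrite /e; nra.
Qed.

(** * Averages of a solution confined to the light cone *)

Section averages.
Context (R : realType) (n : nat).
Local Notation leb := (lebesgue_rV R n).
Variables (m p r : R) (u0 u1 : 'rV[R]_n -> R).
Hypotheses (m_gt0 : 0 < m) (p_gt1 : 1 < p) (r_gt0 : 0 < r).
Hypotheses (test_u0 : test_function u0) (test_u1 : test_function u1).
Hypotheses (u0_ge0 : forall x, 0 <= u0 x) (u1_ge0 : forall x, 0 <= u1 x).
Hypotheses (u0_supp : supp u0 `<=` [set x | enorm x <= r]).
Hypotheses (u1_supp : supp u1 `<=` [set x | enorm x <= r]).

Let phi_ge0 t : 0 <= phi m t.
Proof. by have m0 := m_gt0; rewrite /phi mulr_ge0 ?powR_ge0// divr_ge0//; lra. Qed.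

Let L2_expcut L (w : 'rV[R]_n) : L2 (expcut L w).
Proof.
apply: (@continuous_compact_L2 R n _ (L + 1)); last by move=> x; exact: expcut_neq0.
by have [S _] := test_function_expcut L w; exact: S 0%N.
Qed.

Definition confined_solution (eps : R) (T : \bar R) (u : R -> 'rV[R]_n -> R) :=
  energy_solution m p eps u0 u1 T u /\
  solution_supp T u `<=` [set z | enorm z.2 <= r + phi m z.1].

Let room (T : \bar R) (t : R) : (t%:E < T)%E ->
  exists2 d : R, 0 < d & ((t + 2 * d)%:E < T)%E.
Proof.
case: T => [z| |] //; last by exists 1 => //; rewrite ltry.
rewrite lte_fin => tz; exists ((z - t) / 4); first by lra.
by rewrite lte_fin; lra.
Qed.

(** On the support of the data exp(w.x) >= exp(- r), so the average and its derivative start from at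
    least eps exp(- r) k0 and eps exp(- r) k1, uniformly in w; [growth] then applies. *)
Lemma average_growth : (exists x, u0 x != 0 \/ u1 x != 0) ->
  exists t0 c : R, [/\ 2 <= t0, 0 < c & forall eps T u, 0 < eps ->
    confined_solution eps T u ->
    forall (w : 'rV[R]_n) s, \sum_(i < n) w ord0 i ^+ 2 = 1 ->
      t0 <= s -> (s%:E < T)%E ->
      c * eps * (s `^ (- (m / 4)) * expR (phi m s)) <= exp_average u w s].
Proof.
move=> u01; have [t0 [c [t02 c0 grow]]] := growth m_gt0.
have [k0 [k00 k0P low0]] := initial_lower test_u0 u0_ge0 u0_supp.
have [k1 [k10 k1P low1]] := initial_lower test_u1 u1_ge0 u1_supp.
have k01 : 0 < k0 + k1.
  case: u01 => x [x0|x0]; first by have := k0P (ex_intro _ x x0); lra.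
  by have := k1P (ex_intro _ x x0); lra.
have e0 : 0 < expR (- r) by exact: expR_gt0.
exists t0, (c * (expR (- r) * (k0 + k1))); split=> //.
  by rewrite !mulr_gt0.
move=> eps T u eps0 [[ut [gradu [T0 [H1u cu _] [L2ut _ du] [u0E ut0E] wu]]] su] w s w1 t0s sT.
have s0 : 0 < s by lra.
have [d d0 sdT] := room sT.
have T00 : time_interval T 0 by [].
have p0 : 0 < p by have := p_gt1; lra.
have [v [I [cF cI dF dI [inc [v0 F0]]]]] :=
  energy_identity m_gt0 p0 H1u cu L2ut du wu su w s0 d0 sdT.
set L := r + phi m s + 1 in v0 F0.
have Zr (x : 'rV[R]_n) : enorm x <= r -> expR (- r) <= expcut L w x.
  move=> xr; rewrite expcut_eq; last first.
    move=> i; apply: le_trans (coord_le_enorm x i) _.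
    by have := phi_ge0 s; rewrite /L; lra.
  by rewrite ler_expR; apply: dotp_ge xr.
have [L2u0 _] := H1u 0 T00.
have b0 : eps * (expR (- r) * k0) <= exp_average u w 0.
  rewrite F0; apply: low0 => //; rewrite ?ltW//.
  by move=> x; exact: expcut_ge0.
have b1 : eps * (expR (- r) * k1) <= v 0.
  rewrite v0; apply: low1 => //; rewrite ?ltW//; first exact: L2ut.
  by move=> x; exact: expcut_ge0.
have := @grow _ _ s _ v I _ _ t0s cF cI dF _ _ b0 b1.
rewrite (_ : c * _ = c * (expR (- r) * (k0 + k1)) * eps); last by ring.
apply.
- by rewrite !mulr_ge0 ?expR_ge0// ltW.
- by rewrite !mulr_ge0 ?expR_ge0// ltW.
- by move=> x xs; have := dI x xs; rewrite w1 mul1r.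
- move=> x y x0 xy ys; have := inc x y 0 x0 xy ys (lexx _).
  rewrite mul0r addr0; apply => z _.
  by apply: integral_ge0 => ? _; rewrite lee_fin mulr_ge0 ?powR_ge0 ?expR_ge0.
Qed.

Lemma average_convex eps T u t1 : 0 < eps -> confined_solution eps T u ->
  0 < t1 -> (t1%:E < T)%E ->
  0 <= exp_average u 0 0 /\
  forall x y k, 0 <= x -> x <= y -> y <= t1 -> 0 <= k ->
    (forall s, x <= s <= y -> (k%:E <= exp_power p u 0 s)%E) ->
    exp_average u 0 x + k * (y - x) ^+ 2 / 2 <= exp_average u 0 y.
Proof.
move=> eps0 [[ut [gradu [T0 [H1u cu _] [L2ut _ du] [u0E ut0E] wu]]] su] t10 t1T.
have [d d0 tdT] := room t1T.
have p0 : 0 < p by have := p_gt1; lra.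
have [k0 [_ _ low0]] := initial_lower test_u0 u0_ge0 u0_supp.
have [k1 [_ _ low1]] := initial_lower test_u1 u1_ge0 u1_supp.
have [v [I [cF cI dF dI [inc [v0 F0]]]]] :=
  energy_identity m_gt0 p0 H1u cu L2ut du wu su 0 t10 d0 tdT.
have T00 : time_interval T 0 by [].
have [L2u0 _] := H1u 0 T00.
have low (g g0 : 'rV[R]_n -> R) (k : R) :
    (forall (e e0 : R) (g Z : 'rV[R]_n -> R), 0 <= e -> 0 <= e0 ->
      L2 g -> L2 Z -> {ae leb, forall x, g x = e * g0 x} ->
      (forall x, 0 <= Z x) -> (forall x, enorm x <= r -> e0 <= Z x) ->
      e * (e0 * k) <= \int[leb]_x (g x * Z x)) ->
    L2 g -> {ae leb, forall x, g x = eps * g0 x} ->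
    0 <= \int[leb]_x (g x * expcut (r + phi m t1 + 1) 0 x).
  move=> low g2 gE; have := low eps 0 g _ (ltW eps0) (lexx _) g2 (L2_expcut _ _) gE.
  by rewrite mul0r mulr0; apply => x *; exact: expcut_ge0.
split; first by rewrite F0; exact: low low0 L2u0 u0E.
apply: (integrate_twice cF cI dF _ inc).
- move=> x /dI; rewrite big1 ?mul0r ?mulr0// => i _.
  by rewrite mxE expr0n.
- by move=> s; apply: integral_ge0 => ? _; rewrite lee_fin mulr_ge0 ?powR_ge0 ?expR_ge0.
- by rewrite v0; apply: low low1 (L2ut 0 T00) ut0E.
Qed.

(** [power_lower] with W = 1, where A is the volume of the ball, at most that of the enclosing cube
    and hence at most K^n. With [average_convex] this gives the inequality F'' >= k F^p. *)
Lemma average_power eps T u (K G s : R) : confined_solution eps T u ->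
  0 <= s -> (s%:E < T)%E -> 0 < G -> G <= exp_average u 0 s ->
  0 < K -> r + phi m s <= K / 2 ->
  ((G `^ p * (2 * (2 * K ^+ n) `^ (p - 1))^-1)%:E <= exp_power p u 0 s)%E.
Proof.
move=> [[ut [gradu [T0 [H1u _ _] _ _ _]]] su] s0 sT G0 Gs K0 sK.
have sT' : time_interval T s by split.
have [L2s _] := H1u s sT'.
have K0' : 0 < K ^+ n by rewrite exprn_gt0.
have p10 : 0 < p - 1 by have := p_gt1; lra.
have -> : G `^ p * (2 * (2 * K ^+ n) `^ (p - 1))^-1 =
    G / 2 * (G / (2 * K ^+ n)) `^ (p - 1).
  have Y0 : 0 < 2 * K ^+ n by rewrite mulr_gt0.
  move: (2 * _ ^+ n) Y0 => Y Y0.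
  have YV0 : 0 <= Y^-1 by rewrite invr_ge0 ltW.
  rewrite [in RHS](powRM _ (ltW G0) YV0) -(powR_inv1 (ltW Y0)) -powRrM mulN1r powRN.
  by rewrite -(mulr_powRB1 (ltW G0)) ?invfM; [ring|lra].
have exp0 (x : 'rV[R]_n) : expdot 0 x = 1.
  by rewrite /expdot /dotp big1 ?expR0// => i _; rewrite mxE mul0r.
apply: (@power_lower R n p (r + phi m s)) => //.
- exact: L2_measurable.
- by apply: continuous_measurable_rV; exact: smooth_expdot 0 0%N.
- by move=> x; exact: expR_ge0.
- exact: (solution_supp_ae su sT').
have -> : (\int[leb]_(x in [set x | (enorm x <= r + phi m s)%R]) (expdot 0 x)%:E =
    leb [set x | (enorm x <= r + phi m s)%R])%E.
  under eq_integral => x _ do rewrite exp0.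
  by rewrite integral_cst ?mul1e//; exact: measurable_enorm_le.
have rs0 : 0 <= r + phi m s by rewrite addr_ge0// ltW.
apply: le_trans (volume_enorm_le n rs0) _; rewrite lee_fin.
by apply: lerXn2r; rewrite ?nnegrE ?mulr_ge0 ?(ltW K0)//; lra.
Qed.

End averages.

(** The space has dimension n + 1. The second-order bound is integrated twice only over [t/2, t],
    where s^b >= 2^(-|b|) t^b whatever the sign of b. *)
Lemma average_lower (R : realType) (n : nat) (m p r : R) (u0 u1 : 'rV[R]_n.+1 -> R) :
  0 < m -> 1 < p -> 0 < r -> test_function u0 -> test_function u1 ->
  (forall x, 0 <= u0 x) -> (forall x, 0 <= u1 x) ->
  supp u0 `<=` [set x | enorm x <= r] -> supp u1 `<=` [set x | enorm x <= r] ->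
  (exists x, u0 x != 0 \/ u1 x != 0) ->
  exists t0 c : R, [/\ 2 <= t0, 0 < c & forall eps T u, 0 < eps ->
    confined_solution m p r u0 u1 eps T u ->
    forall t, t0 <= t -> (t%:E < T)%E ->
    c * (eps `^ p * t `^ (n%:R * (2 - p) / 2 * ((m + 2) / 2) - m * p / 4 + 2))
      <= exp_average u 0 t].
Proof.
move=> m0 p1 r0 tu0 tu1 u00 u10 su0 su1 u01.
have [t0 [c [t02 c0 grow]]] := average_growth m0 p1 r0 tu0 tu1 u00 u10 su0 su1 u01.
have [C C0 asym] := power_asymptotics n p m0 r0 c0.
set b := _ - _ in asym *.
(* Doubling [t0] puts t/2 in the range of the power bound; the 8 comes from (t/2)^2 / 2. *)
exists (2 * t0), (C * 2 `^ (- `|b|) / 8); split; first by lra.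
  by rewrite !mulr_gt0 ?powR_gt0 ?invr_gt0.
move=> eps T u eps0 sol t t0t tT; have t_gt0 : 0 < t by lra.
have power s : t0 <= s -> (s%:E < T)%E ->
    ((C * (eps `^ p * s `^ b))%:E <= exp_power p u 0 s)%E.
  move=> t0s sT; have s0 : 0 < s by lra.
  pose ro := r + phi m s; pose G := c * eps * (s `^ (- (m / 4)) * expR (phi m s)).
  have ro0 : 0 < ro.
    by rewrite ltr_pwDl// /phi mulr_ge0 ?powR_ge0// divr_ge0//; lra.
  have G0 : 0 < G by rewrite !mulr_gt0 ?powR_gt0 ?expR_gt0.
  have [[ut [gradu [T0 [H1u _ _] _ _ _]]] su] := sol.
  have sT' : time_interval T s by split => //; exact: ltW.
  have [/L2_measurable mu _] := H1u s sT'.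
  have dir := directional_power p1 ro0 G0 mu (solution_supp_ae su sT')
    (fun w w1 => grow eps T u eps0 sol w s w1 t0s sT).
  have D0 : 0 < (4 * pi) ^+ n * expR ro :> R.
    by rewrite mulr_gt0 ?expR_gt0 ?exprn_gt0// mulr_gt0// pi_gt0.
  have D0E : (0 < ((4 * pi) ^+ n * expR ro)%:E)%E by rewrite lte_fin.
  rewrite -(lee_pmul2l _ D0E)//; apply: le_trans dir; rewrite -EFinM lee_fin mulrC.
  by apply: asym => //; lra.
have [F0 conv] := average_convex m0 p1 tu0 tu1 u00 u10 su0 su1 eps0 sol t_gt0 tT.
have H0 s : (0 <= exp_power p u 0 s)%E.
  by apply: integral_ge0 => ? _; rewrite lee_fin mulr_ge0 ?powR_ge0 ?expR_ge0.
have Fh : 0 <= exp_average u 0 (t / 2).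
  have := conv 0 (t / 2) 0 (lexx _) ltac:(lra) ltac:(lra) (lexx _) (fun s _ => H0 s).
  by rewrite !mul0r addr0; exact: le_trans.
pose k := C * (eps `^ p * (2 `^ (- `|b|) * t `^ b)).
have k0 : 0 <= k by rewrite !mulr_ge0 ?powR_ge0// ltW.
have := conv (t / 2) t k ltac:(lra) ltac:(lra) (lexx _) k0 _.
have -> : k * (t - t / 2) ^+ 2 / 2 = C * 2 `^ (- `|b|) / 8 * (eps `^ p * t `^ (b + 2)).
  rewrite gt0_powRD// (_ : t `^ 2 = t ^+ 2); last by rewrite -powR_mulrn// ltW.
  by rewrite /k; field.
move=> h; apply: le_trans (h _); first by rewrite lerDr.
move=> s /andP[ts st]; have s0 : 0 < s by lra.
apply: le_trans (power s _ _); last 2 first.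
- by lra.
- by apply: le_lt_trans tT; rewrite lee_fin.
rewrite lee_fin /k; rewrite !ler_wpM2l ?powR_ge0 ?(ltW C0)//.
rewrite !powR_expR// -expRD ler_expR.
have l1 : ln s <= ln t by rewrite ler_ln.
have l2 : ln t - ln 2 <= ln s by rewrite -ln_div ?posrE// ler_ln ?posrE//; lra.
have : b * (ln t - ln s) <= `|b| * ln 2.
  apply: le_trans (ler_norm _) _; rewrite normrM ler_wpM2l// ger0_norm; lra.
lra.
Qed.

(** The logarithm of the right-hand side is l0 + (gamma/2) ln t + p (p - 1) ln eps. The choice of t
    cancels ln eps and leaves l0 + (gamma/2) ln K, which is zero at [K0]. *)
Lemma blowup_time (R : realType) (n : nat) (m p c k D : R) : 0 < c -> 0 < k -> 0 < D ->
  0 < gamma m n.+1 p ->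
  exists2 K0 : R, 0 < K0 & forall K eps t : R, K0 <= K -> 0 < eps ->
    t = K * eps `^ (- (2 * p * (p - 1) / gamma m n.+1 p)) ->
    1 <= (2 * (2 * (k * t `^ ((m + 2) / 2)) ^+ n.+1) `^ (p - 1))^-1 / 2 * D * t ^+ 2 *
      (c * (eps `^ p * t `^ (n%:R * (2 - p) / 2 * ((m + 2) / 2) - m * p / 4 + 2))) `^ (p - 1).
Proof.
move=> c0 k0 D0 g0; set ga := gamma m n.+1 p in g0 *.
pose l0 := - ln 2 - (p - 1) * (ln 2 + n.+1%:R * ln k) - ln 2 + ln D + (p - 1) * ln c : R.
exists (expR (- (2 * l0 / ga))); first exact: expR_gt0.
move=> K eps t K0K eps0 tE; have K0 : 0 < K by exact: lt_le_trans (expR_gt0 _) K0K.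
have t0 : 0 < t by rewrite tE mulr_gt0 ?powR_gt0.
have lt : ln t = ln K - 2 * p * (p - 1) / ga * ln eps.
  by rewrite tE lnM ?posrE ?powR_gt0// ln_powR mulNr.
have lK : - (2 * l0) <= ga * ln K.
  have : - (2 * l0 / ga) <= ln K by rewrite -ler_expR lnK.
  rewrite -(ler_pM2l g0); apply: le_trans.
  by rewrite le_eqVlt; apply/orP; left; apply/eqP; field; rewrite gt_eqF.
have -> : (2 * (2 * (k * t `^ ((m + 2) / 2)) ^+ n.+1) `^ (p - 1))^-1 =
    expR (- (ln 2 + (p - 1) * (ln 2 + n.+1%:R * (ln k + (m + 2) / 2 * ln t)))).
  rewrite expRN; congr (_^-1); rewrite expRD lnK ?posrE//; congr (_ * _).
  rewrite [(p - 1) * _]mulrC expRM expRD lnK ?posrE//; congr ((_ * _) `^ _).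
  by rewrite expRM_natl expRD lnK ?posrE// powR_expR.
have -> : c * (eps `^ p * t `^ (n%:R * (2 - p) / 2 * ((m + 2) / 2) - m * p / 4 + 2)) =
   expR (ln c + (p * ln eps + (n%:R * (2 - p) / 2 * ((m + 2) / 2) - m * p / 4 + 2) * ln t)).
  by rewrite !expRD lnK ?posrE// !powR_expR.
rewrite -expRM; have -> : t ^+ 2 = expR (2 * ln t) by rewrite expRM_natl lnK ?posrE.
have half x : expR x / 2 = expR (x - ln 2) :> R by rewrite expRB lnK ?posrE.
rewrite half -[X in _ * X * _ * _](lnK D0) -!expRD; apply: (@le_trans _ _ (expR 0)); first by rewrite expR0.
rewrite ler_expR lt.
(* Total power of t: 2 from the squared time step, a loss from the volume of the support, and p - 1
   times the growth rate of the average. *)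
pose th := 2 - (p - 1) * n.+1%:R * ((m + 2) / 2) +
  (p - 1) * (n%:R * (2 - p) / 2 * ((m + 2) / 2) - m * p / 4 + 2).
have thE : th = ga / 2 by rewrite /th /ga /gamma -natr1; field.
have : p * (p - 1) - th * (2 * p * (p - 1) / ga) = 0 by rewrite thE; field; rewrite gt_eqF.
have {lK} : 0 <= l0 + th * ln K by rewrite thE; lra.
move: (2 * p * (p - 1) / ga) => ka; rewrite /th /l0 => h0 h1.
have : 0 <= l0 + th * ln K + (p * (p - 1) - th * ka) * ln eps.
  by rewrite [_ - th * ka]h1 mul0r addr0.
rewrite /th /l0; congr (0 <= _); ring.
Qed.

Theorem theorem1p2 (R : realType) (n : nat) (m r p : R)
    (u0 u1 : 'rV[R]_n -> R)
    (hn : (1 <= n)%N) (hm : 0 < m) (hr : 0 < r)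
    (hp1 : 1 < p) (hp : p < p_crit m n)
    (hu0 : test_function u0) (hu1 : test_function u1)
    (u0_ge0 : forall x, 0 <= u0 x) (u1_ge0 : forall x, 0 <= u1 x)
    (u0_supp : supp u0 `<=` [set x | enorm x <= r])
    (u1_supp : supp u1 `<=` [set x | enorm x <= r])
    (u01_neq0 : exists x, u0 x != 0 \/ u1 x != 0) :
  exists eps0 C : R, [/\ 0 < eps0, 0 < C &
    forall eps : R, 0 < eps -> eps <= eps0 ->
    forall (T : \bar R) (u : R -> 'rV[R]_n -> R),
      energy_solution_with_lifespan m p eps u0 u1 T u ->
      solution_supp T u `<=` [set z | enorm z.2 <= r + phi m z.1] ->
      (T < +oo)%E /\
      (T <= (C * eps `^ (- (2 * p * (p - 1) / gamma m n p)))%:E)%E].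
Proof.
have p0 : 0 < p by lra.
have g0 := gamma_gt0 hm hn p0 hp.
case: n => [|n] in u0 u1 hn hp hu0 hu1 u0_ge0 u1_ge0 u0_supp u1_supp u01_neq0 g0 *; first by [].
have [t0 [c [t02 c0 low]]] :=
  average_lower hm hp1 hr hu0 hu1 u0_ge0 u1_ge0 u0_supp u1_supp u01_neq0.
pose mu := (m + 2) / 2; have mu0 : 0 < mu by rewrite /mu; lra.
(* Chosen so that r + phi m s <= k2 t^mu / 2 for all s in [0, 2 t] when t >= 1: one constant serves
   the whole blow-up window. *)
pose k2 := 2 * (r + 2 / (m + 2) * 2 `^ mu).
have m20 : 0 < 2 / (m + 2) by rewrite divr_gt0//; lra.
have k20 : 0 < k2 by rewrite mulr_gt0// addr_gt0// mulr_gt0// powR_gt0.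
pose D := (1 - 2 `^ (- ((p - 1) / 2))) ^+ 2.
have D0 : 0 < D.
  rewrite exprn_gt0// subr_gt0 powR_expR// -[ltRHS]expR0 ltr_expR mulNr oppr_lt0.
  by rewrite mulr_gt0 ?ln_gt0//; lra.
have [K0 K00 time] := blowup_time c0 k20 D0 g0.
(* At least [K0] for [blowup_time], and at least [t0] for [average_lower]. *)
pose K := t0 + K0.
(* eps <= 1 makes eps^(-ka) >= 1, hence t >= K; the factor 2 is there because the contradiction
   arises on [t, 2 t]. *)
exists 1, (2 * K); split; rewrite ?mulr_gt0//; first by rewrite /K; lra.
move=> eps eps0 eps1 T u [sol _] su.
set ka := 2 * p * (p - 1) / gamma m n.+1 p in time *.
have eka : 1 <= eps `^ (- ka).
  rewrite powR_expR// -expR0 ler_expR mulNr -mulrN mulr_ge0//.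
    by rewrite divr_ge0 ?(ltW g0)// !mulr_ge0//; lra.
  by rewrite oppr_ge0 ln_le0.
have [t tE] : exists t, t = K * eps `^ (- ka) by exists (K * eps `^ (- ka)).
have tK : K <= t by rewrite tE ler_peMr// /K; lra.
have t0t : t0 <= t by rewrite /K in tK; lra.
have t_gt0 : 0 < t by lra.
suff : (T <= (2 * t)%:E)%E.
  by rewrite tE mulrA => Tt; split=> //; apply: le_lt_trans Tt _; rewrite ltry.
rewrite leNgt; apply/negP => tT.
have cs : confined_solution m p r u0 u1 eps T u by [].
have tT' s : s <= 2 * t -> (s%:E < T)%E.
  by move=> st; apply: le_lt_trans tT; rewrite lee_fin.
have t20 : 0 < 2 * t by lra.
have [_ conv] :=
  average_convex hm hp1 hu0 hu1 u0_ge0 u1_ge0 u0_supp u1_supp eps0 cs t20 tT.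
have := low eps T u eps0 cs t t0t (tT' t ltac:(lra)).
have := time K eps t _ eps0 tE.
set A := c * _; set k := _^-1 => big FA.
have A0 : 0 < A by rewrite !mulr_gt0 ?powR_gt0.
apply: (@doubling_blowup R p k A t (exp_average u 0)) => //; last first.
- by apply: big; rewrite /K; lra.
- move=> x y tx xy yt.
  have H0 s : (0 <= exp_power p u 0 s)%E.
    by apply: integral_ge0 => ? _; rewrite lee_fin mulr_ge0 ?powR_ge0 ?expR_ge0.
  (* With k = 0 convexity makes the average nondecreasing, so on [x, y] the power bound may be taken
     with its value at x. *)
  have mono x1 x2 : 0 <= x1 -> x1 <= x2 -> x2 <= 2 * t ->
      exp_average u 0 x1 <= exp_average u 0 x2.
    move=> x10 x12 x2t; have := conv x1 x2 0 x10 x12 x2t (lexx _) (fun s _ => H0 s).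
    by rewrite !mul0r addr0.
  have Fx : 0 < exp_average u 0 x.
    exact: lt_le_trans A0 (le_trans FA (mono t x (ltW t_gt0) tx (le_trans xy yt))).
  have x0 : 0 <= x by exact: le_trans (ltW t_gt0) tx.
  apply: conv => //.
    by rewrite mulr_ge0 ?powR_ge0// invr_ge0 mulr_ge0 ?powR_ge0.
  move=> s /andP[xs sy]; rewrite mulrC /k.
  apply: (average_power hm hp1 hr cs) => //; first by lra.
  - by apply: tT'; lra.
  - exact: mono x s x0 xs (le_trans sy yt).
  - by rewrite mulr_gt0 ?powR_gt0.
  apply: (@le_trans _ _ ((r + 2 / (m + 2) * 2 `^ mu) * t `^ mu)); last first.
    by rewrite /k2; lra.
  rewrite mulrDl; apply: lerD.
    rewrite ler_peMr ?(ltW hr)// powR_expR// -expR0 ler_expR mulr_ge0 ?(ltW mu0)//.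
    by rewrite ln_ge0//; lra.
  rewrite -[leRHS]mulrA -powRM ?(ltW t_gt0)// /phi -/mu ler_wpM2l ?(ltW m20)//.
  by apply: ge0_ler_powR; rewrite ?nnegrE; lra.
- by rewrite invr_ge0 mulr_ge0 ?powR_ge0.
Qed.
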